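(* Let $Y \subset \mathbb{P}W$ be an irreducible cubic hypersurface with nonzero Hessian defined by a cubic form $f \in \mathrm{Sym}^3 W^*$. Assume that (a) the singular locus $\mathrm{Sing}(Y)$ is nonsingular; and (b) there exists a nonzero $A \in \mathfrak{aut}(\widehat{Y})^{(1)}$ of the form $$A_{uv} = a\,\chi^A(u)\,v + a\,\chi^A(v)\,u + h(f_{uv}) \quad \text{for all } u,v \in W,$$ for some $h \in \mathrm{Hom}(W^*,W)$ and some $a \in \mathbb{C}$ with $a \neq \frac{1}{4}$. If $Y = \mathrm{Sec}(\mathrm{Sing}(Y))$, then there exists an irreducible component $S$ of $\mathrm{Sing}(Y)$ such that $Y = \mathrm{Sec}(S)$.
   Context: Everything is over $\mathbb{C}$; vector spaces are finite-dimensional; $\mathbb{P}W$ is the space of one-dimensional subspaces of $W$. A cubic form $f \in \mathrm{Sym}^3 W^*$ is identified with a symmetric trilinear form $f(u,v,w)$ on $W$. The irreducible (reduced) cubic hypersurface $Y$ is defined by an irreducible $f$: its affine cone is $\widehat{Y} = \{w \in W : f(w,w,w)=0\}$. For $u,v \in W$, $f_{uv} \in W^*$ is the functional $f_{uv}(w) = f(u,v,w)$. $Y$ has nonzero Hessian if there exists $w \in W$ such that $f_{wv} \neq 0$ for every nonzero $v \in W$ (equivalently, this holds for a general $w$). $\mathrm{Sing}(Y)$ is the set of singular points of $Y$ with its reduced structure (a closed algebraic subset, possibly reducible); condition (a) concerns this reduced algebraic set, not the natural scheme structure. $\mathfrak{aut}(\widehat{Y}) \subset \mathrm{End}(W)$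 is the Lie algebra of endomorphisms $\varphi$ such that $\varphi(w)$ lies in the affine tangent space $T_w\widehat{Y} \subset W$ for every nonsingular point $w$ of $\widehat{Y}$; equivalently, there is a (unique) scalar $\chi(\varphi) \in \mathbb{C}$ with $f(\varphi(u),v,w)+f(u,\varphi(v),w)+f(u,v,\varphi(w)) = \chi(\varphi) f(u,v,w)$ for all $u,v,w \in W$. For a symmetric bilinear map $A \in \mathrm{Hom}(S^2W,W)$ write $A_{uv}=A_{vu} \in W$ for its value at $(u,v)$ and $A_w \in \mathrm{End}(W)$ for $A_w(u)=A_{wu}$. Then $\mathfrak{aut}(\widehat{Y})^{(1)}$ is the space of all $A$ with $A_w \in \mathfrak{aut}(\widehat{Y})$ for every $w \in W$. For such $A$, $\chi^A \in W^*$ is defined by $\chi^A(w) = \chi(A_w)$. For an algebraic subset $Z \subset \mathbb{P}W$, the secant variety $\mathrm{Sec}(Z)$ is the closure of the union of the lines joining pairs of distinct points of $Z$. *)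

(* Defs.v *)
From HB Require Import structures.
From mathcomp Require Import all_boot all_order all_algebra.
From mathcomp Require Import boolp classical_sets reals.
From mathcomp Require Import complex mpoly.

Set Implicit Arguments.
Unset Strict Implicit.
Unset Printing Implicit Defensive.

Import GRing.Theory.
Local Open Scope ring_scope.
Local Open Scope classical_set_scope.

Section ProjectiveSpace.
Variables (K : closedFieldType) (W : vectType K).

Definition projpt : Type := {L : {vspace W} | \dim L == 1%N}.

(* Polynomials on W are written in the coordinates of the basis vbasis {:W};
   homogeneity, closedness etc. below do not depend on this choice. *)
Definition evalp (p : {mpoly K[\dim {:W}]}) (w : W) : K :=
  p.@[fun i => coord (vbasis {:W}) i w].

(* d_w p (v), the derivative of p at w in the direction v *)
Definition diffp (p : {mpoly K[\dim {:W}]}) (w v : W) : K :=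
  \sum_(i < \dim {:W}) evalp p^`M(i) w * coord (vbasis {:W}) i v.

Definition vanishes_at (p : {mpoly K[\dim {:W}]}) (x : projpt) : Prop :=
  forall w, w \in val x -> evalp p w = 0.

Definition homogeneous (p : {mpoly K[\dim {:W}]}) : Prop :=
  exists d : nat, p \is d.-homog.

Definition closed_alg (Z : set projpt) : Prop :=
  exists2 P : set {mpoly K[\dim {:W}]},
    (forall p, P p -> homogeneous p) &
    Z = [set x | forall p, P p -> vanishes_at p x].

Definition closure_alg (Z : set projpt) : set projpt :=
  [set x | forall C, closed_alg C -> Z `<=` C -> C x].

Definition irreducible_alg (Z : set projpt) : Prop :=
  [/\ closed_alg Z, Z !=set0 &
      forall Z1 Z2, closed_alg Z1 -> closed_alg Z2 ->
        Z `<=` Z1 `|` Z2 -> Z `<=` Z1 \/ Z `<=` Z2].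

Definition irreducible_component (Z S : set projpt) : Prop :=
  [/\ irreducible_alg S, S `<=` Z &
      forall T, irreducible_alg T -> T `<=` Z -> S `<=` T -> T = S].

Definition secant_variety (Z : set projpt) : set projpt :=
  closure_alg [set z | exists x y : projpt,
    [/\ Z x, Z y, x <> y & (val z <= val x + val y)%VS]].

(* Chains Z_0 < Z_1 < ... < Z_d of irreducible closed subsets of Z, all of them
   containing x; the largest such d is the Krull dimension of the local ring
   of Z at x. *)
Definition local_chain (Z : set projpt) (x : projpt) (d : nat) : Prop :=
  exists c : nat -> set projpt,
    [/\ forall i, (i <= d)%N -> [/\ irreducible_alg (c i), c i x & c i `<=` Z] &
        forall i, (i < d)%N -> c i `<` c i.+1].

Definition local_dim (Z : set projpt) (x : projpt) (d : nat) : Prop :=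
  local_chain Z x d /\ forall e, local_chain Z x e -> (e <= d)%N.

(* The subspace of W whose quotient by the line x is, up to a twist, the Zariski
   tangent space at x of Z with its reduced structure: only the polynomials
   vanishing on the point set Z are used. *)
Definition affine_tangent (Z : set projpt) (x : projpt) : set W :=
  [set v | forall p, homogeneous p -> (forall z, Z z -> vanishes_at p z) ->
     forall w, w \in val x -> diffp p w v = 0].

(* Regularity of the local ring at x: the Zariski tangent space, of dimension
   dim U - 1, has the dimension of Z at x. *)
Definition nonsingular_at (Z : set projpt) (x : projpt) : Prop :=
  exists (d : nat) (U : {vspace W}),
    [/\ local_dim Z x d, affine_tangent Z x = [set v | v \in U] & \dim U = d.+1].

Definition nonsingular (Z : set projpt) : Prop :=
  forall x, Z x -> nonsingular_at Z x.

End ProjectiveSpace.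

Section CubicForms.
Variables (K : closedFieldType) (W : vectType K).

Definition dual := 'Hom(W, K^o).

(* f u v w is the value of a trilinear form; f u v : dual is f_{uv}. *)
Definition trilinear := 'Hom(W, 'Hom(W, dual)).

Definition symmetric_trilinear (f : trilinear) : Prop :=
  forall u v w, f u v w = f v u w /\ f u v w = f u w v.

(* the cubic polynomial w |-> f(w,w,w) in the coordinates of vbasis {:W} *)
Definition cubic_poly (f : trilinear) : {mpoly K[\dim {:W}]} :=
  let e := vbasis {:W} in
  \sum_(i < \dim {:W}) \sum_(j < \dim {:W}) \sum_(k < \dim {:W})
    (f e`_i e`_j e`_k : K) *: ('X_i * 'X_j * 'X_k).

Definition irreducible_mpoly n (p : {mpoly K[n]}) : Prop :=
  [/\ p != 0, p \isn't a GRing.unit &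
      forall q r, p = q * r -> q \is a GRing.unit \/ r \is a GRing.unit].

Definition hypersurface (f : trilinear) : set (projpt W) :=
  [set x : projpt W | forall w, w \in val x -> f w w w = 0].

(* Singular points of the hypersurface with equation cubic_poly f. This is meant
   for irreducible f, where cubic_poly f generates the ideal of the
   hypersurface. *)
Definition Sing (f : trilinear) : set (projpt W) :=
  [set x : projpt W | hypersurface f x /\
     forall w, w \in val x -> forall v, diffp (cubic_poly f) w v = 0].

Definition nonzero_hessian (f : trilinear) : Prop :=
  exists w : W, forall v : W, v != 0 -> f w v != 0.

(* c is the scalar chi(phi) of the infinitesimal automorphism phi *)
Definition multiplier (f : trilinear) (phi : 'End(W)) (c : K) : Prop :=
  forall u v w, f (phi u) v w + f u (phi v) w + f u v (phi w) = c * f u v w.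

Definition aut (f : trilinear) : set 'End(W) :=
  [set phi : 'End(W) | exists c, multiplier f phi c].

(* unique for phi in aut f when f != 0; zero by convention outside aut f *)
Definition chi (f : trilinear) (phi : 'End(W)) : K :=
  xget 0 [set c | multiplier f phi c].

(* A w : 'End(W) is A_w, and A u v is A_{uv}. *)
Definition aut1 (f : trilinear) : set 'Hom(W, 'End(W)) :=
  [set A : 'Hom(W, 'End(W)) |
    (forall u v, A u v = A v u) /\ forall w, aut f (A w)].

End CubicForms.

(* Main.v *)
Require Import Defs.
From HB Require Import structures.
From mathcomp Require Import all_boot all_order all_algebra.
From mathcomp Require Import boolp classical_sets reals.
From mathcomp Require Import complex mpoly.
From mathcomp Require Import ring zify.

Set Implicit Arguments.
Unset Strict Implicit.
Unset Printing Implicit Defensive.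

Import Order.TTheory GRing.Theory Num.Theory.
Local Open Scope ring_scope.

(** The singular locus [Sing f] turns out to be irreducible, so it is itself the
component that is asked for.

Algebra. Write [chi] for the linear form [w |-> chi f (A w)]. Substituting the
assumed form of [A] into the definition of an infinitesimal automorphism gives
an identity in four vectors between [chi], [f] and the bilinear form
[(al, be) |-> be (h al)] on the dual space ([prolongation_id]). Permuting its
arguments shows two things. If [chi] vanished, so would the quadratic form of
[h] on the image of the polar map [w |-> f w w], which is dense because the
Hessian is nonzero; then [A] would be zero ([chi_zero]). As [chi] is not zero,
[a] is 1/2 and [h] is symmetric, since otherwise [chi] would divide the cubic
([half_coefficient]).

Curves. The hypersurface lies in no hyperplane, so its secants cannot all lie
in [chi = 0], and some singular [x] has [chi x = 1]. Then [A x] behaves like the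
multiplication by a primitive idempotent of a Jordan algebra: its eigenvalues
are 1, 1/2 and 0, and the eigenspace for 1 is the line of [x]. This makes many
curves inside [Sing f] explicit. For singular [x], [y] put [B = A x y] and
[d = chi B]; the conic [x + t B + t^2 (d / 4) y] consists of singular vectors,
and so do the lines joining [B] to [x] and [y] when [d = 0] ([conic_singular],
[line_singular]). When [B = 0], [y] lies in the eigenspace for 0, whose singular
vectors form a quadric; this quadric contains a point [p] that a conic joins
to [x] ([square_curve], [square_neq0]), and a line or a conic of the quadric
joins [p] to [y], or else the cubic would be reducible ([quadric_curve]).

Nonsingularity. Through a nonsingular point [p] of a closed set [Z] there is an
irreducible closed subset of [Z] containing all these curves that pass through
[p] ([nonsingular_branch]); this is the geometric content of the fact that a
regular local ring is a domain. Let [T] be the top of a chain of irreducible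
closed sets of maximal length [d] through [p], so that the tangent space of the
cone of [Z] has dimension [d + 1]. By the Artin-Rees lemma, which follows from
Hilbert's basis theorem, the functions on the cone of [T] modulo those of order
[j] at [p] form a space whose dimension is at least a multiple of
[j ^ (d + 1)] ([chain_indep]). A function vanishing on [T] but not along some
curve in [Z] would have, modulo functions vanishing on [Z], a nonzero leading
form on the tangent space ([leading_monomial]), and this would bound that
dimension by a multiple of [j ^ d] ([tangent_span]).

Conclusion. Let [T] be the branch of [Sing f] at [x]. It contains every singular
[y] with [d <> 0], so every irreducible closed subset of [Sing f] through [x] is
contained in it. For the other [y], the branch at [B], or at [p] when [B = 0],
contains both [x] and [y]; hence [y] is in [T], and [Sing f = T]
([Sing_irreducible]). *)

(** * Noetherian rings *)

Definition is_ideal (R : comNzRingType) (I : R -> Prop) : Prop :=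
  [/\ I 0, forall x y, I x -> I y -> I (x + y) & forall a x, I x -> I (a * x)].

Definition ideal_gen (R : comNzRingType) (s : seq R) (x : R) : Prop :=
  exists c : R ^ size s, x = \sum_(i < size s) c i * s`_i.

Definition noetherian (R : comNzRingType) : Prop :=
  forall I : R -> Prop, is_ideal I ->
  exists2 s : seq R, (forall g, g \in s -> I g) & forall x, I x -> ideal_gen s x.

Lemma ideal_sum (R : comNzRingType) (I : R -> Prop) (J : Type) (r : seq J)
    (P : pred J) (F : J -> R) :
  is_ideal I -> (forall j, P j -> I (F j)) -> I (\sum_(j <- r | P j) F j).
Proof.
by case=> I0 ID _ IF; elim/big_rec: _ => // j x Pj Ix; apply/ID/Ix/IF.
Qed.

Lemma idealN (R : comNzRingType) (I : R -> Prop) x : is_ideal I -> I x -> I (- x).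
Proof. by case=> _ _ IM Ix; rewrite -mulN1r; apply: IM. Qed.

Lemma idealB (R : comNzRingType) (I : R -> Prop) x y :
  is_ideal I -> I x -> I y -> I (x - y).
Proof. by move=> Ii Ix Iy; case: (Ii) => _ ID _; apply: ID => //; apply: idealN. Qed.

Lemma ideal_gen_ideal (R : comNzRingType) (s : seq R) : is_ideal (ideal_gen s).
Proof.
split.
- by exists [ffun=> 0]; rewrite big1 // => i _; rewrite ffunE mul0r.
- move=> _ _ [c ->] [d ->]; exists [ffun i => c i + d i].
  by rewrite -big_split; apply: eq_bigr => i _; rewrite ffunE mulrDl.
- move=> a _ [c ->]; exists [ffun i => a * c i].
  by rewrite mulr_sumr; apply: eq_bigr => i _; rewrite ffunE mulrA.
Qed.

Lemma mem_ideal_gen (R : comNzRingType) (s : seq R) g : g \in s -> ideal_gen s g.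
Proof.
move=> /(nthP 0)[i ltis <-]; exists [ffun j => (val j == i)%:R].
rewrite (bigD1 (Ordinal ltis)) //= ffunE eqxx mul1r big1 ?addr0 // => j nji.
by rewrite ffunE (negPf (_ : val j != i)) ?mul0r.
Qed.

Lemma ideal_gen_sub (R : comNzRingType) (s : seq R) (I : R -> Prop) x :
  is_ideal I -> (forall g, g \in s -> I g) -> ideal_gen s x -> I x.
Proof.
move=> Ii Is [c ->]; apply: ideal_sum => // i _.
by case: Ii => _ _; apply; apply: Is; rewrite mem_nth.
Qed.

Lemma noetherian_field (K : fieldType) : noetherian K.
Proof.
move=> I [I0 ID IM].
have [[x Ix nx]|nI] := pselect (exists2 x, I x & x != 0).
  exists [:: x] => [g|y Iy]; first by rewrite inE => /eqP ->.
  by exists [ffun=> y / x]; rewrite big_ord1 ffunE /= divfK.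
exists [::] => // x Ix; exists [ffun=> 0]; rewrite big_ord0.
by apply/eqP; apply/negPn/negP => nx; apply: nI; exists x.
Qed.

Lemma noetherian_image (R S : comNzRingType) (f : {rmorphism R -> S}) :
  (forall y, exists x, f x = y) -> noetherian R -> noetherian S.
Proof.
move=> fsurj nR I [I0 ID IM].
have [|s sI Is] := nR (I \o f).
  split=> /= [|x y|a x]; rewrite ?rmorph0 ?rmorphD ?rmorphM //; first exact: ID.
  exact: IM.
exists (map f s) => [_ /mapP[g gs ->]|y Iy]; first exact: sI.
have [x fx] := fsurj y; have [|c xE] := Is x; first by rewrite /= fx.
rewrite -fx xE rmorph_sum /=; apply: ideal_sum; first exact: ideal_gen_ideal.
move=> i _; rewrite rmorphM; case: (ideal_gen_ideal (map f s)) => _ _; apply.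
by apply: mem_ideal_gen; rewrite map_f ?mem_nth.
Qed.

(** Hilbert's basis theorem. The leading coefficients of the elements of an
ideal form a finitely generated ideal, whose generators are reached in some
degree [d]; below [d], finitely many more ideals of leading coefficients have
to be generated. Cancelling leading terms then lowers the degree. *)
Lemma noetherian_poly (R : comNzRingType) : noetherian R -> noetherian {poly R}.
Proof.
move=> nR I Iid; have [I0 ID IM] := Iid.
pose L n a := exists2 p : {poly R}, I p & (size p <= n.+1)%N /\ p`_n = a.
have Lid n : is_ideal (L n).
  split; first by exists 0 => //; rewrite size_poly0 coef0.
  - move=> _ _ [p Ip [sp <-]] [q Iq [sq <-]]; exists (p + q); first exact: ID.
    by rewrite coefD; split=> //; rewrite (leq_trans (size_polyD _ _)) // geq_max sp.
  - move=> a _ [p Ip [sp <-]]; exists (a%:P * p); first exact: IM.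
    rewrite coefCM; split=> //; rewrite mul_polyC.
    exact: leq_trans (size_scale_leq _ _) sp.
have LS n m a : L n a -> L (n + m)%N a.
  case=> p Ip [sp pn]; exists (p * 'X^m); first by rewrite mulrC; apply: IM.
  rewrite coefMXn ltnNge leq_addl /= addnK; split=> //.
  apply/leq_sizeP => j ltj; rewrite coefMXn; case: ltnP => // lemj.
  by apply: (leq_sizeP _ _ sp); rewrite -addSn in ltj; lia.
have [|s sL Ls] := nR (fun a => exists n, L n a).
  split; first by exists 0%N; case: (Lid 0%N).
  - move=> a b [n La] [m Lb]; exists (n + m)%N; case: (Lid (n + m)%N) => _ + _; apply.
      exact: LS.
    by rewrite addnC; apply: LS.
  - by move=> a b [n Lb]; exists n; case: (Lid n) => _ _; apply.
have [d dL] : exists d, forall g, g \in s -> L d g.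
  elim: s sL {Ls} => [|g s IHs] sL; first by exists 0%N.
  have [|d dL] := IHs; first by move=> h hs; apply: sL; rewrite inE hs orbT.
  have [|n Ln] := sL g; first by rewrite inE eqxx.
  exists (d + n)%N => h; rewrite inE => /predU1P[->|/dL]; last exact: LS.
  by rewrite addnC; apply: LS.
have gensL n : exists2 G : seq {poly R}, (forall g, g \in G -> I g) &
    forall a, L n a -> exists2 p, ideal_gen G p & (size p <= n.+1)%N /\ p`_n = a.
  have [t tL Lt] := nR _ (Lid n).
  pose ch a := xget 0 [set p : {poly R} | I p /\ ((size p <= n.+1)%N /\ p`_n = a)].
  have chP a : a \in t -> I (ch a) /\ ((size (ch a) <= n.+1)%N /\ (ch a)`_n = a).
    by move=> /tL[p Ip pP]; apply: (@xgetPex _ 0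
      [set p : {poly R} | I p /\ ((size p <= n.+1)%N /\ p`_n = a)]); exists p.
  exists (map ch t) => [_ /mapP[a at_ ->]|a La]; first by case: (chP a at_).
  have [c ->] := Lt _ La.
  exists (\sum_(i < size t) (c i)%:P * ch t`_i).
    apply: ideal_sum; first exact: ideal_gen_ideal.
    move=> i _; case: (ideal_gen_ideal (map ch t)) => _ _; apply.
    by apply: mem_ideal_gen; rewrite map_f ?mem_nth.
  split.
    apply: (leq_trans (size_sum _ _ _)); apply/bigmax_leqP => i _.
    rewrite mul_polyC (leq_trans (size_scale_leq _ _)) //.
    by have [_ []] := chP t`_i (mem_nth _ (ltn_ord i)).
  rewrite coef_sum; apply: eq_bigr => i _; rewrite coefCM.
  by have [_ [_ ->]] := chP t`_i (mem_nth _ (ltn_ord i)).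
have [G GI LG] : exists2 G : seq {poly R}, (forall g, g \in G -> I g) &
    forall n a, (n <= d)%N -> L n a ->
    exists2 p, ideal_gen G p & (size p <= n.+1)%N /\ p`_n = a.
  elim: d {dL} => [|d [G GI LG]].
    have [G GI LG] := gensL 0%N; exists G => // n a.
    by rewrite leqn0 => /eqP ->; apply: LG.
  have [G' GI' LG'] := gensL d.+1; exists (G ++ G') => [g|n a].
    by rewrite mem_cat => /orP[/GI|/GI'].
  have sub H p : {subset H <= G ++ G'} -> ideal_gen H p -> ideal_gen (G ++ G') p.
    move=> sH; apply: ideal_gen_sub; first exact: ideal_gen_ideal.
    by move=> g gH; apply/mem_ideal_gen/sH.
  rewrite leq_eqVlt => /predU1P[->|ltnd] La.
    have [p Gp pP] := LG' _ La; exists p => //; apply: sub Gp => g gG.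
    by rewrite mem_cat gG orbT.
  have [p Gp pP] := LG _ _ ltnd La; exists p => //; apply: sub Gp => g gG.
  by rewrite mem_cat gG.
exists G => // p; have [G0 GD GM] := ideal_gen_ideal G.
have [n] := ubnP (size p); elim: n p => // n IHn p ltpn Ip.
have [->//|np] := eqVneq p 0.
suff [q Gq [sq qE]] : exists2 q, ideal_gen G q &
    (size q <= size p)%N /\ q`_(size p).-1 = lead_coef p.
  rewrite -(subrK q p); apply: (GD) => //; apply: IHn; last first.
    by apply: idealB => //; apply: ideal_gen_sub Gq.
  have [->|npq] := eqVneq (p - q) 0.
    by rewrite size_poly0 (leq_trans _ (_ : size p <= n)%N) ?size_poly_gt0.
  suff: (size (p - q)%R < size p)%N by move=> lt; apply: leq_trans lt _; rewrite -ltnS.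
  have sp0 : (0 < size p)%N by rewrite size_poly_gt0.
  rewrite -(prednK sp0) ltnS; apply/leq_sizeP => j; rewrite leq_eqVlt coefB.
  case/predU1P=> [<-|ltj]; first by rewrite qE subrr.
  have ltj' : (size p <= j)%N by rewrite -(prednK sp0).
  by rewrite !nth_default ?subrr // (leq_trans sq).
have sp : size p = (size p).-1.+1 by rewrite prednK ?size_poly_gt0.
have Lp : L (size p).-1 (lead_coef p) by exists p => //; rewrite -sp.
have [led|ltd] := leqP (size p).-1 d.
  by have [q Gq qP] := LG _ _ led Lp; exists q; rewrite // [in X in (_ <= X)%N]sp.
have [|c cE] := Ls (lead_coef p); first by exists (size p).-1.
have [|q Gq [sq qd]] := LG d (lead_coef p) (leqnn _).
  rewrite cE; apply: ideal_sum => // i _; case: (Lid d) => _ _; apply.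
  by apply: dL; rewrite mem_nth.
exists (q * 'X^((size p).-1 - d)); first by rewrite mulrC; apply: GM.
rewrite coefMXn ltnNge leq_subr /= subKn ?(ltnW ltd) //; split=> //.
apply/leq_sizeP => j lej; rewrite coefMXn; case: ltnP => // lt'.
by apply: (leq_sizeP _ _ sq); move: lej ltd; rewrite sp; lia.
Qed.

Lemma mpoly_recr (R : comNzRingType) n (p : {mpoly R[n.+1]}) :
  exists q : {poly {mpoly R[n]}}, p = (map_poly (@mwiden n R) q).['X_ord_max].
Proof.
pose f (q : {poly {mpoly R[n]}}) := (map_poly (@mwiden n R) q).['X_ord_max].
have fD q r : f (q + r) = f q + f r by rewrite /f rmorphD hornerD.
have fM q r : f (q * r) = f q * f r by rewrite /f rmorphM hornerM.
have fC c : f c%:P = mwiden c by rewrite /f map_polyC hornerC.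
have imX i : exists q, 'X_i = f q.
  case: (unliftP ord_max i) => [j ->|->]; last by exists 'X; rewrite /f map_polyX hornerX.
  exists ('X_j)%:P; rewrite fC mwidenX mnmwiden1; congr 'X_(_).
  by apply: val_inj; rewrite [LHS]/= /bump leqNgt ltn_ord.
elim/mpolyind: p => [|c m p _ _ [q ->]]; first by exists 0; rewrite rmorph0 horner0.
suff [r rE] : exists r, 'X_[m] = f r.
  by exists ((c%:MP)%:P * r + q); rewrite -[RHS]/(f _) fD fM fC mwidenC -rE mul_mpolyC.
rewrite mpolyXE_id; elim/big_rec: _ => [|i _ _ [r ->]].
  by exists 1; rewrite /f rmorph1 hornerC.
have [s sE] := imX i; exists (s ^+ m i * r); transitivity (f (s ^+ m i * r)) => //.
rewrite fM sE; congr (_ * _); elim: (m i) => [|k IHk].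
  by rewrite !expr0 /f rmorph1 hornerC.
by rewrite !exprS fM IHk.
Qed.

Lemma noetherian_mpoly (R : comNzRingType) n : noetherian R -> noetherian {mpoly R[n]}.
Proof.
move=> nR; elim: n => [|n IHn].
  apply: (@noetherian_image R _ (@mpolyC 0 R)) => // p.
  by exists p@_0%MM; apply: (mpolyKC p).
have cX : commr_rmorph (@mwiden n R) 'X_ord_max by move=> p; apply: mulrC.
apply: (@noetherian_image _ _ (horner_morph cX)) (noetherian_poly IHn) => p.
by have [q ->] := mpoly_recr p; exists q.
Qed.

(** * Order of vanishing at the origin and the Artin-Rees lemma *)

Definition vanish_order (R : comNzRingType) n (j : nat) (p : {mpoly R[n]}) : Prop :=
  forall m, p@_m != 0 -> (j <= mdeg m)%N.

Lemma vanish_order_ideal (R : comNzRingType) n j : is_ideal (@vanish_order R n j).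
Proof.
split=> [m|p q Pp Pq m|a p Pp m]; first by rewrite mcoeff0 eqxx.
  have [p0|/Pp//] := eqVneq p@_m 0.
  by rewrite mcoeffD p0 add0r => /Pq.
rewrite -mcoeff_msupp => /msuppM_le /allpairsP[[m1 m2] /= [_ + ->]].
by rewrite mcoeff_msupp mdegD => /Pp lej; apply: leq_trans lej (leq_addl _ _).
Qed.

Lemma vanish_orderW (R : comNzRingType) n i j (p : {mpoly R[n]}) :
  (i <= j)%N -> vanish_order j p -> vanish_order i p.
Proof. by move=> leij Pp m /Pp; apply: leq_trans. Qed.

Lemma vanish_orderM (R : comNzRingType) n i j (p q : {mpoly R[n]}) :
  vanish_order i p -> vanish_order j q -> vanish_order (i + j) (p * q).
Proof.
move=> Pp Pq m; rewrite -mcoeff_msupp => /msuppM_le /allpairsP[[m1 m2] /= [+ + ->]].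
by rewrite !mcoeff_msupp mdegD => /Pp lei /Pq lej; apply: leq_add.
Qed.

Lemma vanish_orderX (R : comNzRingType) n m :
  vanish_order (mdeg m) ('X_[m] : {mpoly R[n]}).
Proof.
by move=> m'; rewrite mcoeffX; case: (m =P m') => [->|_]; rewrite ?eqxx.
Qed.

(** A monomial of high degree has a factor of each smaller degree; this lets a
function of order at least [j] be written as a form of degree exactly [j] in the
coordinates, with polynomial coefficients. *)
Lemma mnm_split n (m : 'X_{1..n}) j : (j <= mdeg m)%N ->
  exists m1 m2, m = (m1 + m2)%MM /\ mdeg m1 = j.
Proof.
elim: j => [|j IHj] lej; first by exists 0%MM, m; rewrite add0m mdeg0.
have [m1 [m2 [mE m1j]]] := IHj (ltnW lej).
have m2n : m2 != 0%MM.
  by apply/eqP => m20; move: lej; rewrite mE m20 addm0 m1j ltnn.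
have [i im2] : exists i, m2 i != 0%N.
  apply/existsP; apply: contraNT m2n => /existsPn m2z; apply/eqP.
  by apply/mnmP => i; rewrite mnm0E; apply/eqP/negPn/(m2z i).
exists (m1 + U_(i))%MM, (m2 - U_(i))%MM; split; last by rewrite mdegD mdeg1 m1j addn1.
rewrite mE -addmA; congr (_ + _)%MM; apply/mnmP => k; rewrite !mnmE.
by case: eqP => [<-|_] /=; lia.
Qed.

Section Rees.
Variables (R : comNzRingType) (n : nat).
Local Notation S := {mpoly R[n]}.

(** The image of this map is the Rees ring of the ideal of the origin: its
elements are the polynomials whose [l]-th coefficient has order at least [l]
([rees_coef], [rees_surj]). *)
Definition rees : {mpoly S[n]} -> {poly S} := mmap (@polyC S) (fun i => 'X_i *: 'X).

Lemma reesM : {morph rees : p q / p * q}.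
Proof. by move=> p q; rewrite /rees rmorphM. Qed.

Lemma reesD : {morph rees : p q / p + q}.
Proof. by move=> p q; rewrite /rees raddfD. Qed.

Lemma rees_sum (J : Type) (r : seq J) (F : J -> {mpoly S[n]}) :
  rees (\sum_(j <- r) F j) = \sum_(j <- r) rees (F j).
Proof. by rewrite /rees raddf_sum. Qed.

Lemma reesZX (c : S) m : rees (c *: 'X_[m]) = (c * 'X_[m]) *: 'X^(mdeg m).
Proof.
rewrite /rees mmapZ mmapX /mmap1 /= mul_polyC -scalerA; congr (_ *: _).
rewrite mpolyXE_id mdegE -mul_polyC rmorph_prod /=.
rewrite (big_morph (fun k => 'X^k : {poly S}) (@exprD _ 'X) (expr0 'X)) -big_split /=.
by apply: eq_bigr => i _; rewrite exprZn mul_polyC.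
Qed.

Lemma rees_coef (G : {mpoly S[n]}) l : vanish_order l (rees G)`_l.
Proof.
have [v0 vD vM] := vanish_order_ideal R n l.
rewrite [G]mpolyE rees_sum coef_sum; apply: ideal_sum => // m _.
rewrite reesZX coefZ coefXn; case: eqP => [->|_]; last by rewrite mulr0.
rewrite mulr1; have [_ _ vM'] := vanish_order_ideal R n (mdeg m).
by apply: vM'; apply: vanish_orderX.
Qed.

Lemma rees_surj (M : S) j : vanish_order j M -> exists G, rees G = M *: 'X^j.
Proof.
move=> vM; suff: exists G, rees G = (\sum_(m <- msupp M) M@_m *: 'X_[m]) *: 'X^j.
  by rewrite -mpolyE.
rewrite big_seq; elim/big_rec: _ => [|m p mM [G GE]].
  by exists 0; rewrite scale0r /rees raddf0.
have [m1 [m2 [mE m1j]]] := mnm_split (vM m (etrans (esym (mcoeff_msupp M m)) mM)).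
exists ((M@_m *: 'X_[m2]) *: 'X_[m1] + G).
rewrite scalerDl -GE reesD; congr (_ + _).
rewrite (reesZX (M@_m *: 'X_[m2]) m1) m1j mE mpolyXD -scalerAl.
by rewrite [X in M@__ *: X]mulrC.
Qed.

End Rees.

(** The elements of the Rees ring of the origin whose coefficients lie in
[s S + Q] form an ideal, which has finitely many generators. If [c] exceeds
their degrees, then writing an element of order [j] of [s S + Q] in terms of
them uses coefficients of order at least [j - c]; cancelling [s] gives the claim. *)
Lemma artin_rees (R : comNzRingType) n (Q : {mpoly R[n]} -> Prop) (s : {mpoly R[n]}) :
  noetherian R -> is_ideal Q -> (forall u, Q (s * u) -> Q u) ->
  exists c, forall j u, (exists2 q, Q q & vanish_order j (s * u - q)) ->
    exists2 q, Q q & vanish_order (j - c) (u - q).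
Proof.
move=> nR Qid Qs; have [Q0 QD QM] := Qid.
pose J z := exists u, Q (z - s * u).
have Jid : is_ideal J.
  split; first by exists 0; rewrite mulr0 subrr.
  - move=> x y [u Qu] [v Qv]; exists (u + v).
    by rewrite (_ : _ - _ = (x - s * u) + (y - s * v)); [apply: QD|ring].
  - move=> a x [u Qu]; exists (a * u).
    by rewrite (_ : _ - _ = a * (x - s * u)); [apply: QM|ring].
have [J0 JD JM] := Jid.
pose I (H : {mpoly {mpoly R[n]}[n]}) := forall l, J (rees H)`_l.
have [|gs gI Igs] := @noetherian_mpoly _ n (@noetherian_mpoly _ n nR) I.
  split=> [l|x y Ix Iy l|a x Ix l].
  - by rewrite /rees raddf0 coef0.
  - by rewrite reesD coefD; apply: JD; [apply: Ix|apply: Iy].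
  - by rewrite reesM coefM; apply: ideal_sum => // i _; apply: JM.
pose c := (\max_(g <- gs) size (rees g))%N.
exists c => j u [q Qq vq].
have [G GE] := rees_surj vq.
have [|a aE] := Igs G.
  move=> l; rewrite GE coefZ coefXn; case: (l == j); last by rewrite mulr0.
  rewrite mulr1; exists u.
  by rewrite [_ - _](_ : _ = - q); [apply: idealN|ring].
have ch i l : exists w, Q ((rees gs`_i)`_l - s * w) /\ ((c <= l)%N -> (i < size gs)%N -> w = 0).
  have [/andP[lecl ltis]|] := boolP ((c <= l)%N && (i < size gs)%N).
    exists 0; split=> //; rewrite mulr0 subr0 nth_default ?(leq_trans _ lecl) //.
    by rewrite /c (big_nth 0) big_mkord (bigop.bigmax_sup (Ordinal ltis)).
  rewrite negb_and => ncl; have [ltis|leis] := ltnP i (size gs).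
    have [w Qw] := gI _ (mem_nth 0 ltis) l; exists w; split=> // lecl.
    by move: ncl; rewrite lecl ltis.
  exists 0; split=> //; rewrite mulr0 subr0 (nth_default 0 leis) /rees raddf0.
  by rewrite coef0.
have [w wP] := choice (fun il : nat * nat => ch il.1 il.2).
pose u' := \sum_(i < size gs) \sum_(k < j.+1) (rees (a i))`_k * w (val i, (j - k)%N).
exists (u - u').
  apply: Qs; rewrite [s * _](_ : _ = q + ((s * u - q) - s * u')); last by ring.
  apply: QD => //; have -> : s * u - q = (rees G)`_j.
    by rewrite GE coefZ coefXn eqxx mulr1.
  rewrite aE rees_sum coef_sum /u' mulr_sumr -sumrB; apply: ideal_sum => // i _.
  rewrite reesM coefM mulr_sumr -sumrB; apply: ideal_sum => // k _.
  rewrite [_ - _](_ : _ = (rees (a i))`_k * ((rees gs`_i)`_(j - k) - s * w (val i, (j - k)%N))).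
    by apply: QM; case: (wP (val i, (j - k)%N)).
  by ring.
rewrite subKr; have vid := vanish_order_ideal R n (j - c).
apply: ideal_sum => // i _; apply: ideal_sum => // k _.
have [lec|ltc] := leqP c (j - k).
  have [_ /= -> //] := wP (val i, (j - k)%N).
  by rewrite mulr0; case: vid.
rewrite mulrC; have [_ _] := vid; apply.
by apply: (@vanish_orderW _ _ _ k); [lia|apply: rees_coef].
Qed.

(** * Counting dimensions modulo a subspace *)

Definition is_subspace (K : fieldType) (V : lmodType K) (E : V -> Prop) : Prop :=
  [/\ E 0, forall x y, E x -> E y -> E (x + y) & forall a x, E x -> E (a *: x)].

(** [indep_mod E n] and [span_mod E n] say that the quotient by [E] has dimension
at least, respectively at most, [n]; no quotient has to be formed. *)
Definition indep_mod (K : fieldType) (V : lmodType K) (E : V -> Prop) (n : nat) : Prop :=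
  exists g : 'I_n -> V, forall c : 'I_n -> K,
    E (\sum_i c i *: g i) -> forall i, c i = 0.

Definition span_mod (K : fieldType) (V : lmodType K) (E : V -> Prop) (n : nat) : Prop :=
  exists g : 'I_n -> V, forall v, exists c : 'I_n -> K, E (v - \sum_i c i *: g i).

Lemma subspace_sum (K : fieldType) (V : lmodType K) (E : V -> Prop) (J : Type)
    (r : seq J) (P : pred J) (F : J -> V) :
  is_subspace E -> (forall j, P j -> E (F j)) -> E (\sum_(j <- r | P j) F j).
Proof.
by case=> E0 ED _ EF; elim/big_rec: _ => // j x Pj Ex; apply/ED/Ex/EF.
Qed.

(** More vectors than generators satisfy a linear relation, read off from the
kernel of the matrix expressing them modulo [E]. *)
Lemma indep_le_span (K : fieldType) (V : lmodType K) (E : V -> Prop) k n :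
  is_subspace E -> indep_mod E k -> span_mod E n -> (k <= n)%N.
Proof.
move=> Es [g gE] [h hE]; have [E0 ED EZ] := Es.
have [M ME] := choice (fun i => hE (g i)).
rewrite leqNgt; apply/negP => ltnk.
pose A := \matrix_(i < k, j < n) M i j.
have kA : kermx A != 0.
  rewrite -mxrank_eq0 mxrank_ker subn_eq0 -ltnNge.
  exact: leq_ltn_trans (rank_leq_col A) ltnk.
have /rowV0Pn[r /sub_kermxP rA nr] := kA.
move/negP: nr; apply; apply/eqP/rowP => i; rewrite mxE; move: i.
apply: gE => /=.
rewrite [X in E X](_ : _ = \sum_i r 0 i *: (g i - \sum_j M i j *: h j)).
  by apply: subspace_sum => // i _; apply: EZ.
under [RHS]eq_bigr => i _ do rewrite scalerBr scaler_sumr.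
rewrite sumrB exchange_big /= [X in _ - X]big1 ?subr0 // => j _.
under eq_bigr => i _ do rewrite scalerA.
rewrite -scaler_suml; move/rowP: rA => /(_ j); rewrite !mxE => rAj.
rewrite [X in X *: _](_ : _ = 0) ?scale0r // -[RHS]rAj.
by apply: eq_bigr => i _; rewrite mxE.
Qed.

Definition span_by (K : fieldType) (V : lmodType K) (E : V -> Prop) (T : finType)
    (A : {pred T}) (g : T -> V) (v : V) : Prop :=
  exists c : T -> K, E (v - \sum_(t in A) c t *: g t).

Lemma span_by_subspace (K : fieldType) (V : lmodType K) (E : V -> Prop) (T : finType)
    (A : {pred T}) (g : T -> V) :
  is_subspace E -> is_subspace (span_by E A g).
Proof.
case=> E0 ED EZ; split.
- by exists (fun=> 0); rewrite big1 ?subrr // => i _; rewrite scale0r.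
- move=> x y [c cE] [d dE]; exists (fun t => c t + d t).
  under eq_bigr => t _ do rewrite scalerDl.
  by rewrite big_split opprD addrACA; apply: ED.
- move=> a x [c cE]; exists (fun t => a * c t).
  under eq_bigr => t _ do rewrite -scalerA.
  by rewrite -scaler_sumr -scalerBr; apply: EZ.
Qed.

Lemma span_by_sub (K : fieldType) (V : lmodType K) (E : V -> Prop) (T : finType)
    (A : {pred T}) (g : T -> V) v : E v -> span_by E A g v.
Proof.
move=> Ev; exists (fun=> 0); rewrite big1 ?subr0 // => t _; exact: scale0r.
Qed.

Lemma span_by_mem (K : fieldType) (V : lmodType K) (E : V -> Prop) (T : finType)
    (A : {pred T}) (g : T -> V) t : is_subspace E -> t \in A -> span_by E A g (g t).
Proof.
case=> E0 _ _ At; exists (fun u => (u == t)%:R).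
rewrite (bigD1 t) //= eqxx scale1r big1 ?addr0 ?subrr // => u /andP[_ /negPf ->].
exact: scale0r.
Qed.

Lemma span_modP (K : fieldType) (V : lmodType K) (E : V -> Prop) (T : finType)
    (A : {set T}) (g : T -> V) n :
  is_subspace E -> (forall v, span_by E (mem A) g v) -> (#|A| <= n)%N -> span_mod E n.
Proof.
move=> Es gE leAn.
have -> : n = (#|A| + (n - #|A|))%N by rewrite subnKC.
exists (fun i => match split i with inl j => g (enum_val j) | inr _ => 0 end) => v.
have [c cE] := gE v.
exists (fun i => match split i with inl j => c (enum_val j) | inr _ => 0 end).
move: cE; congr (E (_ - _)); rewrite big_split_ord /=.
rewrite [in RHS]addrC [X in _ = X + _]big1 ?add0r; last first.
  by move=> i _; rewrite (unsplitK (inr i)) scaler0.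
under [RHS]eq_bigr => i _ do rewrite (unsplitK (inl i)).
by rewrite -(big_enum_val (fun t => c t *: g t)).
Qed.

(** * Growth of the local dimension function *)

(** The sum of [Q] and the [j]-th power of the ideal of the origin. The dimension
of the quotient by it is the Hilbert-Samuel function at the origin of the
variety defined by [Q]. *)
Definition nbhd (K : fieldType) N (Q : {mpoly K[N]} -> Prop) j (p : {mpoly K[N]}) : Prop :=
  exists2 q, Q q & vanish_order j (p - q).

Lemma nbhd_ideal (K : fieldType) N (Q : {mpoly K[N]} -> Prop) j :
  is_ideal Q -> is_ideal (nbhd Q j).
Proof.
move=> [Q0 QD QM]; have [v0 vD vM] := vanish_order_ideal K N j; split.
- by exists 0; rewrite ?subrr.
- move=> p q [p' Qp vp] [q' Qq vq]; exists (p' + q'); first exact: QD.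
  by rewrite opprD addrACA; apply: vD.
- move=> a p [p' Qp vp]; exists (a * p'); first exact: QM.
  by rewrite -mulrBr; apply: vM.
Qed.

Lemma ideal_subspace (K : fieldType) N (I : {mpoly K[N]} -> Prop) :
  is_ideal I -> is_subspace I.
Proof. by case=> I0 ID IM; split=> // a x Ix; rewrite -mul_mpolyC; apply: IM. Qed.

Lemma nbhd_sub (K : fieldType) N (Q : {mpoly K[N]} -> Prop) j p : Q p -> nbhd Q j p.
Proof. by move=> Qp; exists p; rewrite ?subrr //; case: (vanish_order_ideal K N j). Qed.

Lemma vanish_nbhd (K : fieldType) N (Q : {mpoly K[N]} -> Prop) j p :
  is_ideal Q -> vanish_order j p -> nbhd Q j p.
Proof. by case=> Q0 _ _ vp; exists 0; rewrite ?subr0. Qed.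

Lemma nbhdW (K : fieldType) N (Q Q' : {mpoly K[N]} -> Prop) i j p :
  (forall q, Q q -> Q' q) -> (i <= j)%N -> nbhd Q j p -> nbhd Q' i p.
Proof.
move=> QQ' leij [q Qq vq]; exists q; first exact: QQ'.
exact: vanish_orderW vq.
Qed.

Lemma indep_modW (K : fieldType) (V : lmodType K) (E E' : V -> Prop) m n :
  (forall v, E' v -> E v) -> (m <= n)%N -> indep_mod E n -> indep_mod E' m.
Proof.
move=> EE' lemn [g gE]; exists (fun i => g (widen_ord lemn i)) => c /EE' Ec i.
pose c' (j : 'I_n) := if insub (val j) is Some i then c (i : 'I_m) else 0.
have c'E (k : 'I_m) : c' (widen_ord lemn k) = c k by rewrite /c' /= valK.
rewrite -c'E; apply: gE; move: Ec; congr (E _).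
rewrite (bigID (fun j : 'I_n => (j < m)%N)) /= [X in _ = _ + X]big1 ?addr0.
  rewrite (big_ord_narrow lemn); apply: eq_bigr => k _.
  by rewrite c'E.
by move=> j nj; rewrite /c' insubF ?scale0r //; apply: negPf.
Qed.

(** By hypothesis, a family independent modulo [nbhd Q j'] stays so modulo
[nbhd Q j] after multiplication by [s]. It then lies in [Q'], so a family
independent modulo [nbhd Q' j] can be added to it. *)
Lemma indep_mod_add (K : fieldType) N (Q Q' : {mpoly K[N]} -> Prop) s j j' a b :
  (forall q, Q q -> Q' q) -> is_ideal Q' -> Q' s ->
  (forall u, nbhd Q j (s * u) -> nbhd Q j' u) ->
  indep_mod (nbhd Q' j) a -> indep_mod (nbhd Q j') b -> indep_mod (nbhd Q j) (a + b).
Proof.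
move=> QQ' Q'id Q's sQ [g gE] [h hE].
exists (fun i => match split i with inl i => g i | inr i => s * h i end) => c.
rewrite big_split_ord /=.
under eq_bigr => i _ do rewrite (unsplitK (inl i)).
under [X in _ + X]eq_bigr => i _ do rewrite (unsplitK (inr i)) scalerAr.
rewrite -mulr_sumr => Ec.
have ca i : c (lshift b i) = 0.
  apply: (gE (c \o lshift b)); have [_ ND _] := nbhd_ideal j Q'id.
  set x := \sum_i _; rewrite -[x](addrK (s * (\sum_(i < b) c (rshift a i) *: h i))).
  apply: ND; first exact: nbhdW Ec.
  apply: nbhd_sub; apply: idealN => //; rewrite mulrC.
  by case: (Q'id) => _ _; apply.
have cb i : c (rshift a i) = 0.
  have -> // := hE (fun k => c (rshift a k)).
  apply: sQ; move: Ec; rewrite big1 ?add0r // => k _.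
  by rewrite ca scale0r.
by move=> i; case: (split_ordP i) => k ->.
Qed.

(** Each step of a chain of primes raises the degree of growth of the
Hilbert-Samuel function by at least one: with the constant [c] of the Artin-Rees
lemma, [indep_mod_add] can be applied [k] times while the order drops by [c * k]
only, each time adding [k ^ d.+1] dimensions. *)
Lemma chain_indep (K : fieldType) N (Q : nat -> {mpoly K[N]} -> Prop) d :
  (forall i, (i <= d)%N -> is_ideal (Q i)) ->
  (forall i, (i < d)%N -> forall q, Q i.+1 q -> Q i q) ->
  (forall i, (i < d)%N -> exists2 s, Q i s & forall u, Q i.+1 (s * u) -> Q i.+1 u) ->
  (forall j, indep_mod (nbhd (Q 0%N) j) j) ->
  exists C, forall k j, (C * k <= j)%N -> indep_mod (nbhd (Q d) j) (k ^ d.+1).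
Proof.
elim: d => [|d IHd] Qid Qdec Qs Q0.
  by exists 1%N => k j lej; apply: indep_modW (Q0 j) => //; rewrite expn1 -[k]mul1n.
have [i lei|i lti|i lti|//|C CP] := IHd; first by apply: Qid; lia.
- by apply: Qdec; lia.
- by apply: Qs; lia.
have [s Qds sQ] := Qs d (ltnSn d).
have [c cP] := artin_rees (@noetherian_field K) (Qid d.+1 (leqnn _)) sQ.
exists (C + c)%N => k.
suff H l j : (C * k + c * l <= j)%N -> indep_mod (nbhd (Q d.+1) j) (l * k ^ d.+1).
  by move=> j lej; rewrite expnS; apply: H; rewrite -mulnDl.
elim: l j => [|l IHl] j lej.
  by exists (fun=> 0) => a _ [].
rewrite mulSn; apply: (@indep_mod_add _ _ _ (Q d) s j (j - c)%N) => //.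
- exact: Qdec.
- by apply: Qid; lia.
- by move=> u su; apply: cP.
- by apply: CP; lia.
- by apply: IHl; lia.
Qed.

(** Modulo [Q] and higher order, a monomial divisible by a coordinate outside [P]
is superfluous. So is a monomial divisible by the greatest monomial [b] in the
coordinates of [P] that occurs in the leading form of [G]: replacing [b] by the
other terms of [G] produces smaller monomials of the same degree, superfluous
ones, and terms of higher order. A monomial not divisible by [b] has some
exponent less than [mdeg b0], which leaves one power of [J] less than all
monomials of order less than [J] in the coordinates of [P]. *)
Lemma tangent_span (K : fieldType) N (Q : {mpoly K[N]} -> Prop) (P : {set 'I_N})
    (G : {mpoly K[N]}) b0 J :
  is_ideal Q -> (forall i, i \notin P -> nbhd Q 2 'X_i) ->
  Q G -> vanish_order (mdeg b0) G -> G@_b0 != 0 -> (forall i, i \notin P -> b0 i = 0%N) ->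
  span_mod (nbhd Q J) (#|P| * (mdeg b0 * J ^ #|P|.-1)).
Proof.
move=> Qid PQ QG vG Gb0 b0P; set o := mdeg b0.
pose supP (m : 'X_{1..N}) := [forall i, (i \notin P) ==> (m i == 0%N)].
have supPn m : ~~ supP m -> exists2 i, i \notin P & m i != 0%N.
  move=> nsup; apply: contrapT => nex; move/negP: nsup; apply.
  apply/forallP => i; apply/implyP => iP; apply/negPn/negP => nmi.
  by apply: nex; exists i.
(* the part of the leading form of G that only involves coordinates in P *)
pose Gt : {mpoly K[N]} :=
  \sum_(m <- msupp G | supP m && (mdeg m == o)) G@_m *: 'X_[m].
have GtE m : Gt@_m = if supP m && (mdeg m == o) then G@_m else 0.
  rewrite /Gt raddf_sum /= -big_filter.
  have [mG|mG] := boolP (m \in [seq m <- msupp G | supP m && (mdeg m == o)]).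
    rewrite (bigD1_seq m) ?filter_uniq ?msupp_uniq //= mcoeffZ mcoeffX eqxx mulr1.
    rewrite big1 ?addr0; last by move=> i /negPf ni; rewrite mcoeffZ mcoeffX ni mulr0.
    by move: mG; rewrite mem_filter => /andP[->].
  rewrite big_seq big1; last first.
    move=> i iG; rewrite mcoeffZ mcoeffX; case: eqP => [im|_]; last by rewrite mulr0.
    by move: mG; rewrite -im iG.
  by move: mG; rewrite mem_filter; case: ifP => //= _; rewrite mcoeff_msupp negbK => /eqP.
have Gtn0 : Gt != 0.
  apply/eqP => /(congr1 (mcoeff b0)); rewrite GtE mcoeff0 eqxx andbT ifT; first exact/eqP.
  by apply/forallP => i; apply/implyP => /b0P ->.
pose b := mlead Gt.
have Gtb : Gt@_b != 0 by rewrite mleadc_eq0.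
have [bP bo] : supP b /\ mdeg b = o.
  by move: Gtb; rewrite GtE; case: ifP => [/andP[? /eqP]|]; rewrite ?eqxx.
have GbE : G@_b = Gt@_b by rewrite GtE bP bo eqxx.
pose mon (a : {ffun 'I_N -> 'I_J}) := [multinom (a i : nat) | i < N].
pose A : {set {ffun 'I_N -> 'I_J}} := [set a | supP (mon a) & ~~ (b <= mon a)%MM].
have Es : is_subspace (nbhd Q J) by apply/ideal_subspace/nbhd_ideal.
have Ss := span_by_subspace (mem A) (fun a => 'X_[mon a] : {mpoly K[N]}) Es.
apply: (span_modP (A := A) (g := fun a => 'X_[mon a])) => //; last first.
  pose F (l i : 'I_N) : pred 'I_J := fun x =>
    if i == l then (x < o)%N else (i \in P) || (val x == 0%N).
  have AF : A \subset \bigcup_(l in P) [set a in family (F l)].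
    apply/fintype.subsetP => a; rewrite inE => /andP[/forallP aP nba].
    have [l ltl] : exists l, (mon a l < b l)%N.
      apply/existsP; apply: contraNT nba => /existsPn ba.
      by apply/mnm_lepP => i; rewrite leqNgt; apply: ba.
    have lP : l \in P.
      apply: contraLR ltl => lP; rewrite -leqNgt.
      by move/forallP/(_ l)/implyP/(_ lP)/eqP: bP => ->.
    apply/bigcupP; exists l => //; rewrite inE; apply/familyP => i; rewrite /F.
    rewrite unfold_in; case: eqP => [->|_].
      move: ltl; rewrite mnmE => /leq_trans; apply; rewrite -bo mdegE.
      by rewrite (bigD1 l) //= leq_addr.
    have [//|iP] := boolP (i \in P).
    by move/implyP/(_ iP): (aP i); rewrite mnmE.
  apply: (leq_trans (subset_leq_card AF)).
  rewrite -sum_nat_const.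
  apply: (big_ind2 (fun (X : {set {ffun 'I_N -> 'I_J}}) n => (#|X| <= n)%N)).
  - by rewrite cards0.
  - move=> X1 n1 X2 n2 le1 le2; apply: leq_trans (leq_add le1 le2).
    by rewrite cardsU leq_subr.
  move=> l lP.
  have ltJ (n : nat) : (#|[pred x : 'I_J | (x < n)%N]| <= n)%N.
    rewrite cardE -(size_map val) -[X in (_ <= X)%N](size_iota 0).
    apply: uniq_leq_size; first by rewrite map_inj_uniq ?enum_uniq //; apply: val_inj.
    by move=> _ /mapP[x + ->]; rewrite mem_enum mem_iota.
  rewrite cardsE card_family foldrE big_image /= (bigD1 l) //= /F eqxx.
  apply: leq_mul; first exact: ltJ.
  apply: (@leq_trans (\prod_(i | i != l) if i \in P then J else 1)%N).
    apply: leq_prod => i /negPf ->; case: ifP => _; first by rewrite cardT size_enum_ord.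
    apply: leq_trans (ltJ 1%N); apply: subset_leq_card; apply/fintype.subsetP => x.
    by rewrite !unfold_in /= ltnS leqn0.
  rewrite -big_mkcondr prod_nat_const [X in (_ ^ X <= _)%N](_ : _ = #|P|.-1) //.
  by rewrite (cardsD1 l P) lP add1n /=; apply: eq_card => i; rewrite !inE unfold_in.
have [S0 SD SZ] := Ss.
move=> F; rewrite [F]mpolyE; apply: subspace_sum => // m _; apply: (SZ).
have [l] := ubnP (J - mdeg m); elim: l m => // l IHl m ltl.
have [leJ|ltJ] := leqP J (mdeg m).
  apply/span_by_sub/vanish_nbhd => //.
  by apply: vanish_orderW leJ _; apply: vanish_orderX.
have higher p : vanish_order (mdeg m).+1 p -> span_by (nbhd Q J) (mem A)
    (fun a => 'X_[mon a] : {mpoly K[N]}) p.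
  move=> vp; rewrite [p]mpolyE big_seq; apply: subspace_sum => // m' m'p; apply: (SZ).
  apply: IHl; move: (vp m'); rewrite -mcoeff_msupp => /(_ m'p); lia.
have outP m' : mdeg m' = mdeg m -> ~~ supP m' -> span_by (nbhd Q J) (mem A)
    (fun a => 'X_[mon a] : {mpoly K[N]}) 'X_[m'].
  move=> m'm /supPn[i /PQ[q Qq vq] nmi].
  have Ui : (U_(i) <= m')%MM by rewrite lep1mP.
  rewrite -(submK Ui) mpolyXD mulrC -[X in X * _](subrK q) mulrDl; apply: (SD).
    apply: higher; have -> : (mdeg m).+1 = (2 + mdeg (m' - U_(i)))%N.
      by rewrite -m'm -[in LHS](submK Ui) mdegD mdeg1 addn1.
    by apply: vanish_orderM => //; apply: vanish_orderX.
  by apply/span_by_sub/nbhd_sub; rewrite mulrC; case: Qid => _ _; apply.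
(* within a degree, the well-founded order on monomials decreases *)
move: (erefl (mdeg m)); move: {1 3}m; elim/(@ltmwf N) => m' IHm m'm.
have [supm|] := boolP (supP m'); last exact: outP.
have [lebm|nlebm] := boolP (b <= m')%MM; last first.
  have ltm i : (m' i < J)%N.
    by apply: leq_ltn_trans ltJ; rewrite -m'm mdegE (bigD1 i) //= leq_addr.
  have monE : mon [ffun i => Ordinal (ltm i)] = m'.
    by apply/mnmP => i; rewrite mnmE ffunE.
  rewrite -[in 'X_[_]]monE.
  by apply: (span_by_mem (fun a => 'X_[mon a])) => //; rewrite inE monE supm.
pose c := (m' - b)%MM; have m'E : m' = (c + b)%MM by rewrite submK.
pose H := G - G@_b *: 'X_[b].
have -> : 'X_[m'] = (G@_b)^-1 *: ('X_[c] * G + - 1 *: ('X_[c] * H)).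
  rewrite m'E mpolyXD scaleN1r -mulrBr subKr -scalerAr scalerA mulVf ?scale1r //.
  by rewrite GbE.
apply: (SZ); apply: (SD).
  by apply/span_by_sub/nbhd_sub; case: Qid => _ _; apply.
apply: (SZ); rewrite [H]mpolyE mulr_sumr big_seq.
apply: subspace_sum => // a aH; rewrite -scalerAr -mpolyXD; apply: (SZ).
have HaE : a != b /\ G@_a != 0.
  move: aH; rewrite mcoeff_msupp mcoeffB mcoeffZ mcoeffX [b == a]eq_sym.
  by have [->|_] := eqVneq a b; rewrite ?mulr1 ?subrr ?eqxx ?mulr0 ?subr0.
have [nab Ga] := HaE.
have := vG _ Ga; rewrite leq_eqVlt => /predU1P[oa|lto]; last first.
  apply: higher; apply: (@vanish_orderW _ _ _ (mdeg (c + a))); last exact: vanish_orderX.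
  by rewrite -m'm m'E !mdegD bo ltn_add2l.
have deg : mdeg (c + a) = mdeg m by rewrite -m'm m'E !mdegD bo -oa.
have [supa|] := boolP (supP a); last first.
  move=> /supPn[i iP nai]; apply: outP => //; apply/negP => /forallP/(_ i).
  by rewrite iP /= mnmDE addn_eq0 (negPf nai) andbF.
apply: IHm => //; rewrite m'E ltmc_add2r lt_neqAle nab.
by apply: msupp_le_mlead; rewrite mcoeff_msupp GtE supa -oa eqxx.
Qed.

Local Open Scope classical_set_scope.

(** * Polynomial functions and polynomial curves *)

Lemma mpoly_ring_ind (R : comNzRingType) n (P : {mpoly R[n]} -> Prop) :
  (forall c, P c%:MP) -> (forall i, P 'X_i) ->
  (forall p q, P p -> P q -> P (p + q)) -> (forall p q, P p -> P q -> P (p * q)) ->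
  forall p, P p.
Proof.
move=> PC PX PD PM p; have PX1 : P 1 by rewrite -mpolyC1.
elim/mpolyind: p => [|c m p _ _ Pp]; first by rewrite -mpolyC0.
apply: PD Pp; rewrite -mul_mpolyC mpolyXE_id; apply: (PM) => //.
elim/big_rec: _ => // i q _ Pq; apply: (PM) Pq.
by elim: (m i) => [|k IHk]; rewrite ?expr0 // exprS; apply: PM.
Qed.

Lemma poly_fun_eq0 (K : numFieldType) (p : {poly K}) :
  (forall t, t != 0 -> p.[t] = 0) -> p = 0.
Proof.
move=> p0; apply/eqP/negPn/negP => np.
have := @max_poly_roots K p [seq i.+1%:R | i <- iota 0 (size p)] np.
rewrite size_map size_iota ltnn => H; apply/notF/H.
  by apply/allP => _ /mapP[i _ ->]; rewrite rootE p0 ?pnatr_eq0.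
by rewrite map_inj_uniq ?iota_uniq // => i j /(mulrIn (oner_neq0 K)) [].
Qed.

Definition along (R : comNzRingType) n (h : 'I_n -> {poly R}) : {mpoly R[n]} -> {poly R} :=
  mmap (@polyC R) h.

Lemma alongD (R : comNzRingType) n (h : 'I_n -> {poly R}) : {morph along h : p q / p + q}.
Proof. by move=> p q; rewrite /along raddfD. Qed.

Lemma alongB (R : comNzRingType) n (h : 'I_n -> {poly R}) : {morph along h : p q / p - q}.
Proof. by move=> p q; rewrite /along raddfB. Qed.

Lemma alongM (R : comNzRingType) n (h : 'I_n -> {poly R}) : {morph along h : p q / p * q}.
Proof. by move=> p q; rewrite /along rmorphM. Qed.

Lemma alongC (R : comNzRingType) n (h : 'I_n -> {poly R}) c : along h c%:MP = c%:P.
Proof. exact: mmapC. Qed.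

Lemma alongX (R : comNzRingType) n (h : 'I_n -> {poly R}) i : along h 'X_i = h i.
Proof. by rewrite /along mmapX mmap1U. Qed.

Lemma horner_along (R : comNzRingType) n (h : 'I_n -> {poly R}) p t :
  (along h p).[t] = p.@[fun i => (h i).[t]].
Proof.
elim/mpoly_ring_ind: p => [c|i|p q IHp IHq|p q IHp IHq].
- by rewrite alongC hornerC mevalC.
- by rewrite alongX mevalXU.
- by rewrite alongD hornerD mevalD IHp IHq.
- by rewrite alongM hornerM mevalM IHp IHq.
Qed.

Lemma deriv_along (R : comNzRingType) n (h : 'I_n -> {poly R}) p :
  (along h p)^`() = \sum_i along h p^`M(i) * (h i)^`().
Proof.
elim/mpoly_ring_ind: p => [c|i|p q IHp IHq|p q IHp IHq].
- by rewrite alongC derivC big1 // => i _; rewrite mderivC alongC mul0r.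
- rewrite alongX (bigD1 i) //= big1 ?addr0 => [|j nji].
    rewrite mderivX mnm1E eqxx scale1r (_ : (U_(i) - U_(i))%MM = 0%MM).
      by rewrite mpolyX0 -mpolyC1 alongC mul1r.
    by apply/mnmP => j; rewrite mnmBE mnm0E subnn.
  by rewrite mderivX mnm1E eq_sym (negPf nji) scale0r -mpolyC0 alongC mul0r.
- rewrite alongD derivD IHp IHq -big_split; apply: eq_bigr => i _.
  by rewrite mderivD alongD mulrDl.
- rewrite alongM derivM IHp IHq mulr_suml mulr_sumr -big_split; apply: eq_bigr => i _ /=.
  by rewrite mderivM alongD !alongM; ring.
Qed.

Lemma along_vanish (R : comNzRingType) n (h : 'I_n -> {poly R}) j p k :
  (forall i, (h i)`_0 = 0) -> vanish_order j p -> (k < j)%N -> (along h p)`_k = 0.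
Proof.
move=> h0 vp ltkj; rewrite /along /mmap coef_sum big_seq big1 // => m mp.
rewrite coefCM [X in _ * X](_ : _ = 0) ?mulr0 //.
have {vp} : (k < mdeg m)%N by apply: leq_trans ltkj _; apply: vp; rewrite -mcoeff_msupp.
suff -> : mmap1 h m = mmap1 (fun i => drop_poly 1 (h i)) m * 'X^(mdeg m).
  by rewrite coefMXn => ->.
rewrite /mmap1 mdegE (big_morph (fun k => 'X^k : {poly R}) (@exprD _ 'X) (expr0 'X)).
rewrite -big_split; apply: eq_bigr => i _ /=; rewrite -exprMn; congr (_ ^+ _).
rewrite -[LHS](poly_take_drop 1) [take_poly 1 _](_ : _ = 0) ?add0r ?expr1 //.
apply/polyP => l; rewrite coef_take_poly coef0; case: ifP => //.
by case: l.
Qed.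

Lemma meval_at0 (R : comNzRingType) n (p : {mpoly R[n]}) : p.@[fun=> 0] = p@_0%MM.
Proof.
elim/mpoly_ring_ind: p => [c|i|p q IHp IHq|p q IHp IHq].
- by rewrite mevalC mcoeffC eqxx mulr1.
- rewrite mevalXU mcoeffX; case: eqP => // /(congr1 mdeg).
  by rewrite mdeg1 mdeg0.
- by rewrite mevalD mcoeffD IHp IHq.
- by rewrite mevalM IHp IHq rmorphM.
Qed.

(** Functions that are polynomial in one affine system of coordinates are
polynomial in any other. *)
Lemma affine_subst (R : comNzRingType) n m (T : Type) (u : T -> 'I_n -> R) (v : T -> 'I_m -> R)
    (A : 'I_n -> 'I_m -> R) (c : 'I_n -> R) (p : {mpoly R[n]}) :
  (forall w i, u w i = \sum_j A i j * v w j + c i) ->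
  exists q : {mpoly R[m]}, forall w, q.@[v w] = p.@[u w].
Proof.
move=> uE.
exists (p \mPo [tuple \sum_j A i j *: 'X_j + (c i)%:MP | i < n]) => w.
rewrite comp_mpoly_meval; apply: meval_eq => i.
rewrite tnth_mktuple mevalD mevalC uE raddf_sum /=; congr (_ + _).
by apply: eq_bigr => j _; rewrite mevalZ mevalXU.
Qed.

(** The subspace is given by a predicate, so it is first realised as the row space
of a matrix of maximal rank among those whose rows belong to it. *)
Lemma separate_subspace (K : fieldType) n (L : 'rV[K]_n -> Prop) (r : 'rV[K]_n) :
  is_subspace L -> ~ L r ->
  exists2 v : 'cV[K]_n, (forall c, L c -> c *m v = 0) & r *m v != 0.
Proof.
move=> [L0 LD LZ] nLr.
pose good k := `[< exists2 M : 'M[K]_n, (forall i, L (row i M)) & \rank M = k >].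
have good0 : exists k, good k.
  exists 0%N; apply/asboolP; exists 0; rewrite ?mxrank0 // => i.
  by rewrite row0.
have goodn k : good k -> (k <= n)%N by move=> /asboolP[M _ <-]; apply: rank_leq_row.
have [k /asboolP[M ML Mk] kmax] := ex_maxnP good0 goodn.
have subL c : (c <= M)%MS -> L c.
  move=> /submxP[D ->]; rewrite mulmx_sum_row.
  by apply: subspace_sum => // i _; apply: LZ.
have Lsub c : L c -> (c <= M)%MS.
  move=> Lc; have [//|ncM] := boolP (c <= M)%MS.
  have : (\rank (M + c)%MS <= k)%N.
    apply: kmax; apply/asboolP; exists (M + c)%MS => // i.
    have /sub_addsmxP[[D1 D2] /= ->] : (row i (M + c)%MS <= M + c)%MS by apply: row_sub.
    apply: LD; first by apply/subL/submxMl.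
    by rewrite [D2]mx11_scalar mul_scalar_mx; apply: LZ.
  rewrite leqNgt -Mk; case/negP; apply: rank_ltmx.
  by rewrite /ltmx addsmxSl addsmx_sub submx_refl.
have : ~~ (r <= M)%MS by apply/negP => /subL.
rewrite submxE => /rV0Pn[j nj]; exists (col j (cokermx M)).
  by move=> c /Lsub; rewrite submxE => /eqP cM; rewrite colE mulmxA cM mul0mx.
rewrite colE mulmxA -colE; apply: contra nj => /eqP /matrixP/(_ 0 0).
by rewrite !mxE => ->.
Qed.

(** * Affine cones *)

Section Cones.
Variables (K : numClosedFieldType) (W : vectType K).
Implicit Types (Z T : set (projpt W)) (w e : W) (p : {mpoly K[\dim {:W}]}).

(** The affine cone over [Z]. It contains 0 as soon as [Z] is nonempty, so curves
that pass through 0 need no special treatment. *)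
Definition cone Z w : Prop := exists2 z, Z z & w \in val z.

Lemma coneZ Z a w : cone Z w -> cone Z (a *: w).
Proof. by case=> z Zz wz; exists z => //; apply: memvZ. Qed.

Lemma coneS Z Z' w : Z `<=` Z' -> cone Z w -> cone Z' w.
Proof. by move=> ZZ' [z /ZZ' Zz wz]; exists z. Qed.

Lemma projpt_gen (z : projpt W) : exists2 w, w != 0 & val z = <[w]>%VS.
Proof.
have /eqP dz := valP z; exists (vpick (val z)).
  by rewrite vpick0 -dimv_eq0 dz.
apply/esym/eqP; rewrite eqEdim -memvE memv_pick dz dim_vline vpick0.
by rewrite -dimv_eq0 dz.
Qed.

Lemma projpt_line (z : projpt W) w : w \in val z -> w != 0 -> val z = <[w]>%VS.
Proof.
move=> wz nw; have /eqP dz := valP z; apply/esym/eqP.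
by rewrite eqEdim -memvE wz dz dim_vline nw.
Qed.

Lemma projptP w : w != 0 -> exists z : projpt W, val z = <[w]>%VS.
Proof.
move=> nw; have dw : \dim <[w]> == 1%N by rewrite dim_vline nw.
by exists (exist _ <[w]>%VS dw).
Qed.

Lemma coneP Z (z : projpt W) w : w \in val z -> w != 0 -> cone Z w -> Z z.
Proof.
move=> wz nw [z' Zz' wz']; suff -> : z = z' by [].
by apply: val_inj; rewrite (projpt_line wz nw) (projpt_line wz' nw).
Qed.

Lemma evalpZ d p a w : p \is d.-homog -> evalp p (a *: w) = a ^+ d * evalp p w.
Proof.
move=> /dhomogP ph; rewrite /evalp !mevalE mulr_sumr !big_seq.
apply: eq_bigr => m mp; rewrite mulrCA; congr (_ * _).
under eq_bigr => i _ do rewrite linearZ /= exprMn.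
by rewrite big_split /= prodrXr -mdegE (ph m mp).
Qed.

Lemma vanishes_atP d p (z : projpt W) w : p \is d.-homog -> w \in val z -> w != 0 ->
  (vanishes_at p z <-> evalp p w = 0).
Proof.
move=> ph wz nw; split=> [|pw w']; first by apply.
rewrite (projpt_line wz nw) => /vlineP[a ->].
by rewrite (evalpZ _ _ ph) pw mulr0.
Qed.

Lemma homog_mderiv d p i : p \is d.-homog -> p^`M(i) \is d.-1.-homog.
Proof.
move=> /dhomogP ph; apply/dhomogP => m; rewrite mcoeff_msupp mcoeff_deriv => nm.
have := ph (m + U_(i))%MM; rewrite mcoeff_msupp => <-.
  by rewrite /= mdegD mdeg1 addn1.
by apply: contraNneq nm => ->; rewrite mul0rn.
Qed.

Lemma diffpZ d p a w v : p \is d.-homog -> diffp p (a *: w) v = a ^+ d.-1 * diffp p w v.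
Proof.
move=> ph; rewrite /diffp mulr_sumr; apply: eq_bigr => i _.
by rewrite (evalpZ _ _ (homog_mderiv i ph)) mulrA.
Qed.

Lemma diffp_deriv p w v (q : {poly K}) :
  (forall t, q.[t] = evalp p (w + t *: v)) -> diffp p w v = q^`().[0].
Proof.
move=> qE.
pose h i : {poly K} := (coord (vbasis {:W}) i w)%:P + coord (vbasis {:W}) i v *: 'X.
have -> : q = along h p.
  apply/eqP; rewrite -subr_eq0; apply/eqP/poly_fun_eq0 => t _.
  rewrite hornerD hornerN qE horner_along; apply/eqP; rewrite subr_eq0; apply/eqP/meval_eq => i.
  by rewrite hornerD hornerC hornerZ hornerX linearD linearZ /= mulrC.
rewrite deriv_along horner_sum; apply: eq_bigr => i _.
rewrite hornerM horner_along derivD derivC derivZ derivX add0r hornerZ hornerC mulr1.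
congr (_ * _); apply: meval_eq => j.
by rewrite hornerD hornerC hornerZ hornerX mulr0 addr0.
Qed.

Definition zeros p : set (projpt W) := [set x | vanishes_at p x].

Lemma zeros_closed p : homogeneous p -> closed_alg (zeros p).
Proof.
move=> ph; exists [set p] => [_ -> //|]; apply/seteqP; split=> x /=.
  by move=> px _ ->.
by apply.
Qed.

(** Irreducibility is a statement about homogeneous polynomials. It gives
cancellation for all polynomial functions because a cone is stable under
scaling: the homogeneous components of a function vanishing on it vanish on it. *)
Lemma irreducible_cancel T s d F (x : projpt W) :
  irreducible_alg T -> s \is d.-homog -> T x -> ~ vanishes_at s x ->
  (forall w, cone T w -> evalp s w * evalp F w = 0) ->
  forall w, cone T w -> evalp F w = 0.
Proof.
move=> [_ _ Tirr] sh Tx nsx sF.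
have FE w : evalp F w = \sum_(l < msize F) evalp (pihomog mdeg l F) w.
  by rewrite {1}(pihomog_partitionE (leqnn (msize F))) /evalp raddf_sum.
have comp w l : cone T w -> evalp s w != 0 -> evalp (pihomog mdeg l F) w = 0.
  move=> Tw nsw; pose q := \poly_(l < msize F) evalp (pihomog mdeg l F) w.
  have [ltl|lel] := ltnP l (msize F); last first.
    rewrite pihomogE big_seq_cond big1 => [|m /andP[/msize_mdeg_lt + /eqP ml]].
      by rewrite /evalp meval0.
    by rewrite ml ltnNge lel.
  suff q0 : q = 0 by move/polyP/(_ l): q0; rewrite coef_poly ltl coef0.
  apply: poly_fun_eq0 => t nt; rewrite horner_poly.
  have /eqP := sF _ (coneZ t Tw); rewrite (evalpZ _ _ sh) -mulrA mulf_eq0.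
  rewrite expf_eq0 (negPf nt) andbF mulf_eq0 (negPf nsw) /= FE => /eqP; apply: etrans.
  by apply: eq_bigr => i _; rewrite (evalpZ _ _ (pihomogP _ _ _)) mulrC.
move=> w Tw; rewrite FE big1 // => l _.
have lh : homogeneous (pihomog mdeg l F) by exists l; apply: pihomogP.
have [] := Tirr (zeros s) (zeros (pihomog mdeg l F)).
- by apply: zeros_closed; exists d.
- exact: zeros_closed.
- move=> z Tz; have [v nv zv] := projpt_gen z; have vz : v \in val z by rewrite zv memv_line.
  have [sv|nsv] := eqVneq (evalp s v) 0.
    by left; apply/(vanishes_atP sh vz nv).
  right; apply/(vanishes_atP (pihomogP _ _ _) vz nv); apply: comp => //.
  by exists z.
- by move=> /(_ x Tx).
by move=> Tl; case: Tw => z /Tl zl wz; apply: zl.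
Qed.

Lemma closed_separate Z (x : projpt W) : closed_alg Z -> ~ Z x ->
  exists p, [/\ homogeneous p, forall z, Z z -> vanishes_at p z & ~ vanishes_at p x].
Proof.
case=> P Ph -> /existsNP[p /not_implyP[Pp px]].
by exists p; split=> //; [apply: Ph|move=> z; apply].
Qed.

End Cones.

(** * Centred coordinates *)

Section Centred.
Variables (K : numClosedFieldType) (W : vectType K).
Variables (b : (\dim {:W}).-tuple W) (e : W).
Hypothesis bW : basis_of {:W} b.
Implicit Types (Z T : set (projpt W)).
Local Notation N := (\dim {:W}).
Local Notation S := {mpoly K[N]}.

(** The value at [w] of a polynomial in the coordinates in the basis [b] of
[w - e], so that [vanish_order] is the order of vanishing at [e]. *)
Definition evc (G : S) (w : W) : K := G.@[fun i => coord b i (w - e)].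

Lemma basis_expand w : w = \sum_(i < N) coord b i w *: b`_i.
Proof. exact: coord_basis bW (memvf w). Qed.

Lemma vbasis_expand w : w = \sum_(i < N) coord (vbasis {:W}) i w *: (vbasis {:W})`_i.
Proof. exact: coord_basis (vbasisP _) (memvf w). Qed.

Lemma centre (F : S) : exists G, forall w, evc G w = evalp F w.
Proof.
apply: (@affine_subst _ _ _ W (fun w i => coord (vbasis {:W}) i w)
  (fun w i => coord b i (w - e))
  (fun i j => coord (vbasis {:W}) i b`_j) (fun i => coord (vbasis {:W}) i e)) => w i.
rewrite -{1}[w](subrK e) linearD /=; congr (_ + _).
rewrite {1}[w - e]basis_expand linear_sum; apply: eq_bigr => j _.
by rewrite linearZ /= mulrC.
Qed.

Lemma decentre (G : S) : exists F, forall w, evalp F w = evc G w.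
Proof.
apply: (@affine_subst _ _ _ W (fun w i => coord b i (w - e))
  (fun w i => coord (vbasis {:W}) i w)
  (fun i j => coord b i (vbasis {:W})`_j) (fun i => - coord b i e)) => w i.
rewrite linearB /=; congr (_ - _).
rewrite {1}[w]vbasis_expand linear_sum; apply: eq_bigr => j _.
by rewrite linearZ /= mulrC.
Qed.

Definition vanish_on Z (G : S) : Prop := forall w, cone Z w -> evc G w = 0.

Lemma vanish_on_ideal Z : is_ideal (vanish_on Z).
Proof.
split=> [w _|p q pZ qZ w Zw|a p pZ w Zw]; first exact: meval0.
  by rewrite /evc mevalD -/(evc p w) -/(evc q w) pZ ?qZ ?addr0.
by rewrite /evc mevalM -/(evc p w) pZ ?mulr0.
Qed.

(** The restriction of a function to the curve [e + t q + t^2 r], see [on_curveE];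
the centre [e] is absorbed by the coordinates. *)
Definition on_curve (q r : W) : S -> {poly K} :=
  along (fun i => coord b i q *: 'X + coord b i r *: 'X^2).

Lemma on_curveE q r G t : (on_curve q r G).[t] = evc G (e + t *: q + t ^+ 2 *: r).
Proof.
rewrite /on_curve horner_along; apply: meval_eq => i.
rewrite hornerD !hornerZ hornerX hornerXn.
rewrite (_ : _ - e = t *: q + t ^+ 2 *: r); last by rewrite -[e + _ + _]addrA addrAC subrr add0r.
by rewrite linearD !linearZ /=; congr (_ + _); apply: mulrC.
Qed.

Lemma on_curve_vanish q r j G k : vanish_order j G -> (k < j)%N -> (on_curve q r G)`_k = 0.
Proof.
apply: along_vanish => i.
by rewrite coefD !coefZ coefX coefXn !mulr0 addr0.
Qed.

Lemma diffp_centre (F G : S) v : (forall w, evc G w = evalp F w) ->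
  diffp F e v = \sum_(i < N) G@_U_(i) * coord b i v.
Proof.
move=> GF.
rewrite (@diffp_deriv _ _ F e v (on_curve v 0 G)) => [|t]; last first.
  by rewrite on_curveE scaler0 addr0 GF.
rewrite /on_curve deriv_along horner_sum; apply: eq_bigr => i _.
rewrite hornerM horner_along; congr (_ * _).
  transitivity (G^`M(i)).@[fun=> 0].
    by apply: meval_eq => j; rewrite hornerD !hornerZ hornerX hornerXn expr0n !mulr0 addr0.
  by rewrite meval_at0 mcoeff_deriv add0m mnm0E mulr1n.
by rewrite linear0 scale0r addr0 derivZ derivX hornerZ hornerC mulr1.
Qed.

End Centred.

(** * Curves through a nonsingular point *)

Section Nonsingular.
Variables (K : numClosedFieldType) (W : vectType K).
Implicit Types (Z T : set (projpt W)).
Local Notation N := (\dim {:W}).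

Lemma adapted_basis (U : {vspace W}) : exists2 b : N.-tuple W, basis_of {:W} b &
  forall w, (w \in U) <-> (forall i : 'I_N, (\dim U <= i)%N -> coord b i w = 0).
Proof.
have UC : (U + U^C)%VS = fullv by apply: addv_complf.
have dUC : directv (U + U^C) by apply/directv_addP/capv_compl.
have bW : basis_of {:W} (vbasis U ++ vbasis U^C).
  by rewrite -UC; apply: cat_basis => //; apply: vbasisP.
have sb : size (vbasis U ++ vbasis U^C) == N.
  by rewrite (@vector.size_basis _ _ _ _ (in_tuple (vbasis U ++ vbasis U^C)) bW).
exists (Tuple sb) => // w; split=> [wU i lei|w0].
  rewrite (coord_vbasis wU) linear_sum big1 // => j _; rewrite linearZ /=.
  have lejN : (j < N)%N by apply: leq_trans (ltn_ord j) (dimvS (subvf U)).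
  have -> : (vbasis U)`_j = (Tuple sb)`_(Ordinal lejN).
    by rewrite nth_cat size_tuple /= ltn_ord.
  rewrite coord_free ?(basis_free bW) // (_ : _ == _ = false) ?mulr0 //.
  by apply/negbTE; rewrite neq_ltn (leq_trans (ltn_ord j) lei).
rewrite (coord_basis (X := Tuple sb) bW (memvf w)).
apply: memv_suml => i _; have [lei|lti] := leqP (\dim U) i.
  by rewrite w0 // scale0r mem0v.
by apply/memvZ/vbasis_mem; rewrite nth_cat size_tuple lti mem_nth // size_tuple.
Qed.

Variables (b : N.-tuple W) (e : W).
Hypothesis bW : basis_of {:W} b.

(** Already on the line of [e] there are functions of each order at [e], namely
the powers of a coordinate on this line. *)
Lemma indep_on_line Z j : e != 0 -> cone Z e ->
  indep_mod (nbhd (vanish_on b e Z) j) j.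
Proof.
move=> ne Ze.
have [i ei] : exists i, coord b i e != 0.
  apply: contrapT => /forallNP e0; case/eqP: ne.
  rewrite (basis_expand bW e) big1 // => i _.
  by have /negP/negPn/eqP -> := e0 i; rewrite scale0r.
pose s : {mpoly K[N]} := (coord b i e)^-1 *: 'X_i.
have sE : on_curve b e 0 s = 'X.
  rewrite /on_curve /s -mul_mpolyC alongM alongC alongX linear0 scale0r addr0.
  by rewrite -mul_polyC mulrA -polyCM mulVf // mul1r.
exists (fun l : 'I_j => s ^+ l) => c [q qZ vq] l.
have := on_curve_vanish b e 0 vq (ltn_ord l).
have q0 : on_curve b e 0 q = 0.
  apply: poly_fun_eq0 => t _; rewrite (on_curveE b e) scaler0 addr0.
  by apply: qZ; rewrite -{1}[e]scale1r -scalerDl; apply: coneZ.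
rewrite /on_curve alongB -/(on_curve b e 0) q0 subr0.
rewrite /on_curve /along raddf_sum /= coef_sum (bigD1 l) //= big1 => [|k nkl].
  rewrite addr0 mmapZ rmorphXn /= -/(along _ _) -/(on_curve _ _ _) sE.
  by rewrite mul_polyC coefZ coefXn eqxx mulr1.
rewrite mmapZ rmorphXn /= -/(along _ _) -/(on_curve _ _ _) sE.
rewrite mul_polyC coefZ coefXn (_ : (l == k :> nat) = false) ?mulr0 //.
by apply: contraNF nkl => /eqP lk; apply/eqP/val_inj.
Qed.

(** By definition the tangent space is the common kernel of the differentials of
the functions vanishing on [Z]. By duality these differentials are all the linear
forms killing it, and in an adapted basis the coordinates beyond its dimension
are among them. *)
Lemma tangent_coord Z (x : projpt W) (U : {vspace W}) : e != 0 -> e \in val x -> Z x ->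
  affine_tangent Z x = [set v | v \in U] ->
  (forall w, (w \in U) <-> (forall i : 'I_N, (\dim U <= i)%N -> coord b i w = 0)) ->
  forall i : 'I_N, (\dim U <= i)%N -> nbhd (vanish_on b e Z) 2 'X_i.
Proof.
move=> ne ex Zx ZU bU i lei.
have Iid := vanish_on_ideal b e Z; have [I0 ID IM] := Iid.
pose L (c : 'rV[K]_N) := exists2 G, vanish_on b e Z G & forall j, G@_U_(j) = c 0 j.
have Ls : is_subspace L.
  split.
  - by exists 0 => // j; rewrite mcoeff0 mxE.
  - move=> c c' [G GZ Gc] [G' GZ' Gc']; exists (G + G'); first exact: ID.
    by move=> j; rewrite mcoeffD mxE Gc Gc'.
  - move=> a c [G GZ Gc]; exists (a%:MP * G); first exact: IM.
    by move=> j; rewrite mcoeffCM mxE Gc.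
have [[G GZ Gi]|nLi] := pselect (L (delta_mx 0 i)).
  exists G => // m; rewrite mcoeffB mcoeffX.
  have [m0|m1] := posnP (mdeg m).
    move/eqP: m0; rewrite mdeg_eq0 => /eqP ->.
    have -> : G@_0%MM = 0.
      have Ze : cone Z e by exists x.
      rewrite -meval_at0 -[RHS](GZ e Ze); apply: meval_eq => j.
      by rewrite subrr linear0.
    by case: (U_(i)%MM =P _) => [/(congr1 mdeg)|_]; rewrite ?mdeg1 ?mdeg0 // subr0 eqxx.
  have [m2|//] := leqP (mdeg m) 1.
  have /mdeg1P[j /eqP ->] : mdeg m == 1%N by rewrite eqn_leq m2.
  by rewrite -(mcoeffX K) mcoeffXU Gi mxE eqxx /= [j == i]eq_sym subrr eqxx.
have [v vL] := separate_subspace Ls nLi.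
rewrite [delta_mx _ _ *m v](_ : _ = (v i 0)%:M); last first.
  by rewrite -rowE; apply/matrixP => k l; rewrite !ord1 !mxE mulr1n.
move=> nvi; case/eqP: nvi.
pose w := \sum_j v j 0 *: b`_j.
have wj j : coord b j w = v j 0.
  rewrite /w linear_sum (bigD1 j) //= linearZ /= coord_free ?(basis_free bW) //.
  rewrite eqxx mulr1 big1 ?addr0 // => k nkj.
  by rewrite linearZ /= coord_free ?(basis_free bW) // (negPf nkj) mulr0.
suff : w \in U by move/bU/(_ i lei); rewrite wj => ->; apply/matrixP => k l; rewrite !mxE mul0rn.
suff : affine_tangent Z x w by rewrite ZU.
move=> p [d ph] pZ w'; rewrite (projpt_line ex ne) => /vlineP[a ->].
rewrite (diffpZ _ _ _ ph); have [G GE] := centre e bW p.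
rewrite (diffp_centre w GE) [X in _ * X](_ : _ = 0) ?mulr0 //.
have : L (\row_j G@_U_(j)).
  exists G => [u [z Zz uz]|j]; last by rewrite mxE.
  by rewrite GE; apply: pZ uz.
move/vL/matrixP/(_ 0 0); rewrite !mxE => E; rewrite -[RHS]E.
by apply: eq_bigr => j _; rewrite mxE wj.
Qed.

(** The order of [F] along the curve bounds the order of all functions congruent
to [F] modulo [Q]. For one of greatest order, the leading form cannot consist
of monomials divisible by coordinates of order two: replacing these coordinates
would raise the order. *)
Lemma leading_monomial (Q : {mpoly K[N]} -> Prop) (P : {set 'I_N}) q r F :
  is_ideal Q -> (forall G, Q G -> on_curve b q r G = 0) ->
  (forall i, i \notin P -> nbhd Q 2 'X_i) -> on_curve b q r F != 0 ->
  exists G m, [/\ Q (F - G), vanish_order (mdeg m) G, G@_m != 0 &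
    forall i, i \notin P -> m i = 0%N].
Proof.
move=> Qid Qcurve PQ Fn0.
have [k Fk] : exists k, ~ nbhd Q k F.
  apply: contrapT => /forallNP FQ; move/eqP: Fn0; apply.
  apply/polyP => k; rewrite coef0.
  have /contrapT[G QG vG] := FQ k.+1.
  have := on_curve_vanish b q r vG (ltnSn k).
  by rewrite /on_curve alongB -!/(on_curve _ _ _) (Qcurve _ QG) subr0.
have [o [Fo FSo]] : exists o, nbhd Q o F /\ ~ nbhd Q o.+1 F.
  elim: k Fk => [[]|k IHk FSk]; first exact: vanish_nbhd.
  by have [Fk|/IHk] := pselect (nbhd Q k F); first by exists k.
have [z Qz vz] := Fo; exists (F - z).
suff [m [mo Gm mP]] : exists m, [/\ mdeg m = o, (F - z)@_m != 0 &
    forall i, i \notin P -> m i = 0%N].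
  by exists m; split=> //; rewrite ?subKr ?mo.
apply: contrapT => nm; apply: FSo; rewrite -(subrK z F).
have [_ ND NM] := nbhd_ideal o.+1 Qid; apply: (ND); last exact: nbhd_sub.
rewrite [F - z]mpolyE big_seq; apply: ideal_sum; first exact: nbhd_ideal.
move=> m; rewrite mcoeff_msupp => mF; rewrite -mul_mpolyC; apply: (NM).
have := vz _ mF; rewrite leq_eqVlt => /predU1P[om|ltom]; last first.
  by apply: vanish_nbhd => //; apply: vanish_orderW ltom _; apply: vanish_orderX.
have [i iP mi] : exists2 i, i \notin P & m i != 0%N.
  apply: contrapT => ni; apply: nm; exists m; split=> // i iP.
  by apply/eqP/negPn/negP => mi; apply: ni; exists i.
have [u Qu vu] := PQ i iP.
have Ui : (U_(i) <= m)%MM by rewrite lep1mP.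
rewrite -(submK Ui) mpolyXD mulrC -[X in X * _](subrK u) mulrDl; apply: (ND).
  apply: vanish_nbhd => //; have -> : o.+1 = (2 + mdeg (m - U_(i)))%N.
    by rewrite om -[in LHS](submK Ui) mdegD mdeg1 addn1.
  by apply: vanish_orderM => //; apply: vanish_orderX.
by apply: nbhd_sub; rewrite mulrC; case: Qid => _ _; apply.
Qed.

End Nonsingular.

(** Curves in [Z] through a nonsingular point stay in one irreducible closed
subset of [Z], the top [c d] of a chain of maximal length. Otherwise the lower
bound [chain_indep] and the upper bound [tangent_span] for the dimension of the
functions on [c d] of order less than [C * k] would contradict each other for
large [k]. *)
Lemma nonsingular_branch (K : numClosedFieldType) (W : vectType K) (Z : set (projpt W))
    (x : projpt W) (e : W) :
  nonsingular_at Z x -> e != 0 -> e \in val x ->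
  exists T, [/\ irreducible_alg T, T x, T `<=` Z & forall q r,
    (forall t, cone Z (e + t *: q + t ^+ 2 *: r)) ->
    forall t, cone T (e + t *: q + t ^+ 2 *: r)].
Proof.
move=> [d [U [[[c [cirr clt]] _] ZU dU]]] ne ex.
have [Tirr Tx TZ] := cirr d (leqnn d); exists (c d); split=> // q r Zqr t.
have Zx : Z x := TZ _ Tx.
have [b bW bU] := adapted_basis U.
pose P : {set 'I_(\dim {:W})} := [set i : 'I_(\dim {:W}) | (i < d.+1)%N]%SET.
have cP : #|P| = d.+1.
  have leUN : (d.+1 <= \dim {:W})%N by rewrite -dU dimvS ?subvf.
  have inj : injective (widen_ord leUN) by move=> i j /(congr1 val) /= /val_inj.
  rewrite -[RHS]card_ord -(card_imset _ inj).
  apply: eq_card => i; rewrite inE; apply/idP/imsetP => [lti|[j _ ->]]; last exact: (ltn_ord j).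
  by exists (Ordinal lti) => //; apply: val_inj.
have PZ i : i \notin P -> nbhd (vanish_on b e Z) 2 'X_i.
  by rewrite inE -leqNgt -dU => lei; apply: (tangent_coord bW ne ex Zx ZU bU).
have Iid := vanish_on_ideal b e.
have Isub T1 T2 G : T1 `<=` T2 -> vanish_on b e T2 G -> vanish_on b e T1 G.
  by move=> T12 GT w /(coneS T12); apply: GT.
have cS i : (i < d)%N -> c i `<=` c i.+1 by move=> /clt; apply: properW.
have [||||C CP] := @chain_indep K _ (fun i => vanish_on b e (c i)) d.
- by move=> i _; apply: Iid.
- by move=> i lti G; apply: Isub; apply: cS.
- move=> i lti; have [ciirr _ _] := cirr i (ltnW lti); have [cSirr _ _] := cirr i.+1 lti.
  have [y cSy ncy] : exists2 y, c i.+1 y & ~ c i y.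
    by apply: contrapT => ny; case: (clt i lti) => _; apply=> y cy; apply: contrapT => ncy;
       apply: ny; exists y.
  have [cicl _ _] := ciirr.
  have [p [[k ph] pc py]] := closed_separate cicl ncy.
  have [s sE] := centre e bW p; exists s.
    by move=> w [z cz wz]; rewrite sE; apply: pc wz.
  move=> u su w cw; have [F FE] := decentre b e u.
  rewrite -FE; apply: (irreducible_cancel cSirr ph cSy py _ cw) => w' cw'.
  by rewrite -sE FE /evc -mevalM; apply: su.
- move=> j; have [_ c0x _] := cirr 0%N (leq0n d).
  by apply: indep_on_line => //; exists x.
have key F : vanish_on b e (c d) F -> on_curve b q r F = 0.
  move=> FT; apply/eqP/negPn/negP => nF.
  have Zcurve G : vanish_on b e Z G -> on_curve b q r G = 0.
    by move=> GZ; apply: poly_fun_eq0 => s _; rewrite (on_curveE b e) GZ.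
  have [G [m [GF vG Gm mP]]] := leading_monomial (Iid Z) Zcurve PZ nF.
  have GT : vanish_on b e (c d) G.
    by rewrite -[G](subKr F); apply: (idealB (Iid _) FT (Isub _ _ _ TZ GF)).
  have PT i : i \notin P -> nbhd (vanish_on b e (c d)) 2 'X_i.
    by move=> /PZ; apply: nbhdW => // G'; apply: Isub.
  (* the least k for which k ^ d.+1 exceeds the bound d.+1 * (mdeg m * (C * k) ^ d) *)
  pose k := (d.+1 * (mdeg m * C ^ d)).+1.
  have Es : is_subspace (nbhd (vanish_on b e (c d)) (C * k)).
    by apply/ideal_subspace/nbhd_ideal.
  have := indep_le_span Es (CP k _ (leqnn _)) (tangent_span (C * k) (Iid _) PT GT vG Gm mP).
  rewrite cP /= expnMn expnS leqNgt => /negP; apply.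
  have k0 : (0 < k ^ d)%N by rewrite expn_gt0.
  rewrite !mulnA ltn_pmul2r // -mulnA; exact: ltnSn.
have [w0|nw] := eqVneq (e + t *: q + t ^+ 2 *: r) 0.
  by exists x => //; rewrite w0 mem0v.
have [y yE] := projptP nw; exists y; last by rewrite yE memv_line.
have [[Pc Pch cE] _ _] := Tirr; rewrite cE => p Pcp.
have [k ph] := Pch p Pcp.
have yw : e + t *: q + t ^+ 2 *: r \in val y by rewrite yE memv_line.
apply/(vanishes_atP ph yw nw); have [s sE] := centre e bW p.
rewrite -sE -on_curveE key ?horner0 // => w [z]; rewrite cE => cz wz.
by rewrite sE; apply: (cz p Pcp).
Qed.

(** * Cubic forms as trilinear forms *)

Lemma mpoly_fun_eq0 (K : numFieldType) n (p : {mpoly K[n]}) :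
  (forall v, p.@[v] = 0) -> p = 0.
Proof.
elim: n p => [|n IHn] p p0.
  by rewrite -(mpolyKC p) -meval_at0 p0 mpolyC0.

have [q qE] := mpoly_recr p.
have wE (r : {mpoly K[n]}) v : (mwiden r).@[v] = r.@[fun i => v (widen_ord (leqnSn n) i)].
  elim/mpoly_ring_ind: r => [c|i|r s IHr IHs|r s IHr IHs].
  - by rewrite mwidenC !mevalC.
  - by rewrite mwidenX mnmwiden1 !mevalXU.
  - by rewrite mwidenD !mevalD IHr IHs.
  - by rewrite mwidenM !mevalM IHr IHs.
rewrite qE (_ : q = 0) ?rmorph0 ?horner0 //; apply/polyP => j; rewrite coef0.
apply: IHn => v.
suff q0 : map_poly (meval v) q = 0 by rewrite -coef_map q0 coef0.
apply: poly_fun_eq0 => t _.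
pose v' (i : 'I_n.+1) := if unlift ord_max i is Some j then v j else t.
rewrite -[RHS](p0 v') qE (horner_coef_wide _ (size_poly _ _)).
rewrite [in RHS](horner_coef_wide _ (size_poly _ _)) (raddf_sum (meval v')).
apply: eq_bigr => i _; rewrite !coef_map /= mevalM rmorphXn /= mevalXU wE.
rewrite /v' unlift_none; congr (_ * _); apply: meval_eq => k.
suff -> : widen_ord (leqnSn n) k = lift ord_max k by rewrite liftK.
by apply: val_inj; rewrite [RHS]/= /bump leqNgt ltn_ord.
Qed.

Section LinearFunctions.
Variables (K : fieldType) (W : vectType K).

Definition is_linear (phi : W -> K) : Prop :=
  forall a u v, phi (a *: u + v) = a * phi u + phi v.

Definition is_bilinear (B : W -> W -> K) : Prop :=
  (forall v, is_linear (B^~ v)) /\ (forall u, is_linear (B u)).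

Lemma is_linear0 phi : is_linear phi -> phi 0 = 0.
Proof. by move=> L; have := L (-1) 0 0; rewrite scaler0 addr0 mulN1r addNr. Qed.

Lemma is_linearD phi u v : is_linear phi -> phi (u + v) = phi u + phi v.
Proof. by move=> L; rewrite -[u in LHS]scale1r L mul1r. Qed.

Lemma is_linearZ phi a u : is_linear phi -> phi (a *: u) = a * phi u.
Proof. by move=> L; rewrite -[_ *: _]addr0 L is_linear0 ?addr0. Qed.

Lemma is_linearN phi u : is_linear phi -> phi (- u) = - phi u.
Proof. by move=> L; rewrite -scaleN1r is_linearZ // mulN1r. Qed.

Lemma is_linearE phi : is_linear phi ->
  (forall u v, phi (u + v) = phi u + phi v) * (forall c u, phi (c *: u) = c * phi u) *
  (forall u, phi (- u) = - phi u).
Proof.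
by move=> L; do ?split=> *; rewrite ?is_linearD ?is_linearZ ?is_linearN.
Qed.

(** Linear functions separate vectors: identities between linear combinations
of vectors become identities between scalars. *)
Lemma vec_ext (u v : W) : (forall phi, is_linear phi -> phi u = phi v) -> u = v.
Proof.
move=> uv; rewrite (coord_basis (vbasisP _) (memvf u)) (coord_basis (vbasisP _) (memvf v)).
apply: eq_bigr => i _; congr (_ *: _); apply: (uv (fun w => coord (vbasis {:W}) i w)).
by move=> c x y; rewrite linearP.
Qed.

Lemma is_linear_sum phi n (c : 'I_n -> K) (u : 'I_n -> W) : is_linear phi ->
  phi (\sum_i c i *: u i) = \sum_i c i * phi (u i).
Proof.
move=> L; elim/big_rec2: _ => [|i x y _ <-]; first exact: is_linear0.
exact: L.
Qed.

End LinearFunctions.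

Section Cubic.
Variables (K : numClosedFieldType) (W : vectType K) (f : trilinear W).
Hypothesis f_sym : symmetric_trilinear f.
Local Notation N := (\dim {:W}).
Local Notation vb := (vbasis {:W}).

Lemma trilinear_l v w : is_linear (fun u => f u v w : K).
Proof. by move=> a x y; rewrite linearP add_lfunE scale_lfunE add_lfunE scale_lfunE. Qed.

Lemma trilinear_m u w : is_linear (fun v => f u v w : K).
Proof. by move=> a x y; rewrite linearP add_lfunE scale_lfunE. Qed.

Lemma trilinear_r u v : is_linear (fun w => f u v w : K).
Proof. by move=> a x y; rewrite linearP. Qed.

Lemma evalp_sum (c : 'I_N -> K) w : evalp (\sum_i c i *: 'X_i) w = \sum_i c i * coord vb i w.
Proof.
by rewrite /evalp raddf_sum; apply: eq_bigr => i _; rewrite /= mevalZ mevalXU.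
Qed.

Lemma evalp_inj (p q : {mpoly K[N]}) : (forall w, evalp p w = evalp q w) -> p = q.
Proof.
move=> pq; apply/eqP; rewrite -subr_eq0; apply/eqP/mpoly_fun_eq0 => v.
pose w := \sum_i v i *: vb`_i.
have wv i : coord vb i w = v i.
  rewrite /w linear_sum (bigD1 i) //= linearZ /= coord_free ?(basis_free (vbasisP _)) //.
  rewrite eqxx mulr1 big1 ?addr0 // => k nki.
  by rewrite linearZ /= coord_free ?(basis_free (vbasisP _)) // (negPf nki) mulr0.
rewrite mevalB; apply/eqP; rewrite subr_eq0; apply/eqP.
by have := pq w; rewrite /evalp !(meval_eq _ wv).
Qed.

Lemma linear_coord phi w : is_linear phi -> phi w = \sum_(i < N) coord vb i w * phi vb`_i.
Proof. by move=> L; rewrite {1}[w]vbasis_expand is_linear_sum. Qed.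

Lemma evalp_cubic w : evalp (cubic_poly f) w = f w w w.
Proof.
rewrite (linear_coord w (trilinear_l w w)) /evalp /cubic_poly raddf_sum.
apply: eq_bigr => i _; rewrite (linear_coord w (trilinear_m _ w)) mulr_sumr raddf_sum.
apply: eq_bigr => j _; rewrite (linear_coord w (trilinear_r _ _)) !mulr_sumr raddf_sum.
apply: eq_bigr => k _; rewrite /= mevalZ !mevalM !mevalXU; ring.
Qed.

Lemma linear_mpoly (phi : W -> K) : is_linear phi ->
  exists2 p : {mpoly K[N]}, p@_0%MM = 0 & forall w, evalp p w = phi w.
Proof.
move=> L; exists (\sum_(i < N) phi vb`_i *: 'X_i) => [|w].
  rewrite raddf_sum big1 // => i _; rewrite /= mcoeffZ mcoeffX.
  by case: (_ =P _) => [/(congr1 mdeg)|_]; rewrite ?mulr0 // mdeg1 mdeg0.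
rewrite evalp_sum (linear_coord w L).
by apply: eq_bigr => i _; rewrite mulrC.
Qed.

Lemma bilinear_mpoly (B : W -> W -> K) : is_bilinear B ->
  exists2 p : {mpoly K[N]}, p@_0%MM = 0 & forall w, evalp p w = B w w.
Proof.
move=> [Bl Br]; have [q qE] := choice (fun i : 'I_N =>
  let: ex_intro2 q q0 qE := linear_mpoly (Br vb`_i) in ex_intro _ q (conj q0 qE)).
exists (\sum_(i < N) 'X_i * q i) => [|w].
  by rewrite raddf_sum big1 // => i _; rewrite /= rmorphM /= (proj1 (qE i)) mulr0.
rewrite /evalp raddf_sum (linear_coord w (Bl w)); apply: eq_bigr => i _.
by rewrite /= mevalM mevalXU -(proj2 (qE i)).
Qed.

(** All uses of irreducibility go through this form of it. The factors have no
constant term, so neither is a unit. *)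
Lemma cubic_not_product (phi : W -> K) (B : W -> W -> K) :
  irreducible_mpoly (cubic_poly f) -> is_linear phi -> is_bilinear B ->
  ~ (forall w, f w w w = phi w * B w w).
Proof.
move=> [_ _ irr] /linear_mpoly[p p0 pE] /bilinear_mpoly[q q0 qE] fE.
have nonunit (r : {mpoly K[N]}) : r@_0%MM = 0 -> r \isn't a GRing.unit.
  move=> r0; apply/negP => /divrr /(congr1 (mcoeff 0%MM)) /eqP.
  by rewrite rmorphM /= r0 mul0r mcoeff1 eqxx eq_sym oner_eq0.
have [|pu|qu] := irr p q.
- by apply: evalp_inj => w; rewrite evalp_cubic fE -pE -qE /evalp mevalM.
- by move/negP: (nonunit p p0).
- by move/negP: (nonunit q q0).
Qed.

Lemma cubicD u v t : f (u + t *: v) (u + t *: v) (u + t *: v) =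
  f u u u + 3 * t * f u u v + 3 * t ^+ 2 * f u v v + t ^+ 3 * f v v v :> K.
Proof.
have [S1 S2] : (f v u u = f u u v :> K) /\ (f v v u = f u v v :> K).
  split; first by rewrite (f_sym v u u).1 (f_sym u v u).2.
  by rewrite (f_sym v v u).2 (f_sym v u v).1.
rewrite ![u + _]addrC !(trilinear_l, trilinear_m, trilinear_r) S1 S2.
rewrite (f_sym u v u).2 (f_sym v u v).1; ring.
Qed.

Lemma diffp_cubic w v : diffp (cubic_poly f) w v = 3 * (f w w v : K).
Proof.
rewrite (@diffp_deriv _ _ _ w v ((f w w w : K)%:P + (3 * f w w v : K) *: 'X
   + (3 * f w v v : K) *: 'X^2 + (f v v v : K) *: 'X^3)) => [|t].
  by rewrite !derivE !hornerE /=; ring.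
by rewrite evalp_cubic cubicD !(hornerD, hornerZ, hornerC, hornerX, hornerXn); ring.
Qed.

(** The differential of the cubic at [w] is [3 * f w w]. *)
Lemma SingP (x : projpt W) w : w \in val x -> w != 0 ->
  Sing f x <-> forall v, f w w v = 0 :> K.
Proof.
move=> wx nw; split=> [[_ /(_ w wx) fx] v|fw].
  have /eqP := fx v; rewrite diffp_cubic mulf_eq0 pnatr_eq0 /=.
  by move/eqP.
split=> w'; rewrite (projpt_line wx nw) => /vlineP[a ->].
  rewrite (is_linearZ _ _ (trilinear_l _ _)) (is_linearZ _ _ (trilinear_m _ _)).
  by rewrite fw !mulr0.
move=> v; rewrite diffp_cubic.
rewrite (is_linearZ _ _ (trilinear_l _ _)) (is_linearZ _ _ (trilinear_m _ _)).
by rewrite fw !mulr0.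
Qed.

Lemma cone_Sing w : cone (Sing f) w -> forall v, f w w v = 0 :> K.
Proof.
move=> [x Sx wx] v; have [->|nw] := eqVneq w 0; last exact: (proj1 (SingP wx nw)) Sx v.
by rewrite (is_linear0 (trilinear_l _ _)).
Qed.

Lemma Sing_cone w : w != 0 -> (forall v, f w w v = 0 :> K) -> cone (Sing f) w.
Proof.
move=> nw fw; have [x xE] := projptP nw.
have wx : w \in val x by rewrite xE memv_line.
by exists x => //; apply/(SingP wx nw).
Qed.

Lemma closed_linear (phi : W -> K) : is_linear phi ->
  closed_alg [set x : projpt W | forall w, w \in val x -> phi w = 0].
Proof.
move=> L; have [p ph pE] : exists2 p : {mpoly K[N]}, p \is 1.-homog & forall w, evalp p w = phi w.
  exists (\sum_(i < N) phi vb`_i *: 'X_i) => [|w].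
    by apply: rpred_sum => i _; apply: rpredZ; rewrite dhomogX /= mdeg1.
  rewrite evalp_sum (linear_coord w L).
  by apply: eq_bigr => i _; rewrite mulrC.
rewrite (_ : mkset _ = zeros p); first by apply: zeros_closed; exists 1%N.
apply/seteqP; split=> x xp w wx; first by rewrite pE xp.
by rewrite -pE xp.
Qed.

End Cubic.

(** * The prolongation *)

Section Prolongation.
Variables (K : numClosedFieldType) (W : vectType K) (f : trilinear W).
Hypothesis f_sym : symmetric_trilinear f.
Hypothesis f_irr : irreducible_mpoly (cubic_poly f).
Variables (h : 'Hom(dual W, W)) (a : K) (chiA : W -> K).
Hypothesis chi_lin : is_linear chiA.

Let T u v w : K := f u v w.
(** With [T] for [f] and [k] for [h_at], the value of the bilinear form
[(al, be) |-> be (h al)] at [f w u] and [f v z] is [T v z (k w u)]. *)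
Definition h_at (u v : W) : W := h (f u v).
Local Notation k := h_at.

(** The vector [A w u] of the prolongation, with [chiA w] for the multiplier of
[A w]. *)
Definition amap (w u : W) : W := (a * chiA w) *: u + (a * chiA u) *: w + k w u.

Hypothesis amap_mult : forall w u v z,
  T (amap w u) v z + T u (amap w v) z + T u v (amap w z) = chiA w * T u v z.

Lemma f_swap12 u v w : T u v w = T v u w. Proof. exact: (f_sym u v w).1. Qed.
Lemma f_swap23 u v w : T u v w = T u w v. Proof. exact: (f_sym u v w).2. Qed.

Lemma fDr u v w w' : T u v (w + w') = T u v w + T u v w'.
Proof. exact: is_linearD (trilinear_r f u v). Qed.
Lemma fZr u v c w : T u v (c *: w) = c * T u v w.
Proof. exact: is_linearZ (trilinear_r f u v). Qed.
Lemma fDm u v v' w : T u (v + v') w = T u v w + T u v' w.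
Proof. exact: is_linearD (trilinear_m f u w). Qed.
Lemma fZm u c v w : T u (c *: v) w = c * T u v w.
Proof. exact: is_linearZ (trilinear_m f u w). Qed.
Lemma fDl u u' v w : T (u + u') v w = T u v w + T u' v w.
Proof. exact: is_linearD (trilinear_l f v w). Qed.
Lemma fZl c u v w : T (c *: u) v w = c * T u v w.
Proof. exact: is_linearZ (trilinear_l f v w). Qed.
Lemma f0r u v : T u v 0 = 0. Proof. exact: is_linear0 (trilinear_r f u v). Qed.
Lemma fNr u v w : T u v (- w) = - T u v w.
Proof. by rewrite -scaleN1r fZr mulN1r. Qed.
Lemma fNm u v w : T u (- v) w = - T u v w.
Proof. by rewrite -scaleN1r fZm mulN1r. Qed.
Lemma fNl u v w : T (- u) v w = - T u v w.
Proof. by rewrite -scaleN1r fZl mulN1r. Qed.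
Definition f_linE := (fDl, fDm, fDr, fZl, fZm, fZr, fNl, fNm, fNr).

Lemma h_atC u v : k u v = k v u.
Proof.
by rewrite /k /h_at; congr (h _); apply/lfunP => w; apply: (f_sym u v w).1.
Qed.

Lemma h_at_eq u v u' v' c : (forall z, T u v z = c * T u' v' z) -> k u v = c *: k u' v'.
Proof.
move=> E; rewrite /h_at -linearZ; congr (h _); apply/lfunP => z.
by rewrite scale_lfunE; apply: E.
Qed.

(** What it means for all [amap w] to be infinitesimal automorphisms. The left
side is symmetric in the four vectors up to the antisymmetric part of [h]. *)
Lemma prolongation_id w u v z :
  T v z (k w u) + T u z (k w v) + T u v (k w z) =
  (1 - 3 * a) * chiA w * T u v z
  - a * (chiA u * T w v z + chiA v * T w u z + chiA z * T w u v).
Proof.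
have := amap_mult w u v z; rewrite /amap !f_linE.
rewrite (f_swap12 (k w u) v z) (f_swap23 v (k w u)) (f_swap23 u (k w v)).
rewrite (f_swap12 u w z) (f_swap23 u v w) (f_swap12 u w v) => E.
apply/eqP; rewrite -subr_eq0; apply/eqP.
set X := (X in X = 0).
have -> : X = (a * chiA w * T u v z + a * chiA u * T w v z + T v z (k w u) +
   (a * chiA w * T u v z + a * chiA v * T w u z + T u z (k w v)) +
   (a * chiA w * T u v z + a * chiA z * T w u v + T u v (k w z))) - chiA w * T u v z.
  by rewrite /X; ring.
by rewrite E subrr.
Qed.

(** In the combination (w) + (u) - (v) - (z) of [prolongation_id] for the four
choices of the first vector, the symmetric part of [h] cancels. *)
Lemma antisym_id w u v z :
  2 * (T v z (k w u) - T w u (k v z)) =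
  (1 - 2 * a) * (chiA w * T u v z + chiA u * T w v z - chiA v * T w u z - chiA z * T w u v).
Proof.
have E1 := prolongation_id w u v z; have E2 := prolongation_id u w v z.
have E3 := prolongation_id v w u z; have E4 := prolongation_id z w u v.
rewrite (h_atC u w) (f_swap12 u w z) (f_swap12 u w v) in E2.
rewrite (h_atC v w) (h_atC v u) (f_swap12 v u z) (f_swap12 v w z) (f_swap12 v w u) (f_swap23 w v u) in E3.
rewrite (h_atC z w) (h_atC z u) (h_atC z v) (f_swap12 z u v) (f_swap23 u z v) in E4.
rewrite (f_swap12 z w v) (f_swap23 w z v) (f_swap12 z w u) (f_swap23 w z u) in E4.
apply/eqP; rewrite -subr_eq0; apply/eqP; set X := (X in X = 0).
move: E1 E2 E3 E4.
set l1 := (X in X = _ -> _); set r1 := (X in _ = X -> _) => E1.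
set l2 := (X in X = _ -> _); set r2 := (X in _ = X -> _) => E2.
set l3 := (X in X = _ -> _); set r3 := (X in _ = X -> _) => E3.
set l4 := (X in X = _ -> _); set r4 := (X in _ = X -> _) => E4.
have -> : X = (l1 - r1) + (l2 - r2) - (l3 - r3) - (l4 - r4).
  by rewrite /X /l1 /r1 /l2 /r2 /l3 /r3 /l4 /r4; ring.
by rewrite E1 E2 E3 E4 !subrr !subr0 addr0.
Qed.

Section Hessian.
Variable w0 : W.
Hypothesis hess : forall v, v != 0 -> f w0 v != 0.

Lemma hess_inj u : (forall z, T w0 u z = 0) -> u = 0.
Proof.
move=> u0; apply/eqP; apply: contraTT isT => /hess /eqP [].
by apply/lfunP => z; rewrite zero_lfunE; apply: u0.
Qed.

Lemma hess_surj (alpha : dual W) : exists u, f w0 u = alpha.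
Proof.
have ker0 : lker (f w0) == 0%VS.
  apply/lker0P => u v uv; apply/eqP; rewrite -subr_eq0; apply/eqP/hess_inj => z.
  by rewrite /T linearB /= uv subrr zero_lfunE.
have img : limg (f w0) = fullv.
  apply/eqP; rewrite eqEdim subvf /= limg_dim_eq; last by rewrite (eqP ker0) capv0.
  by rewrite !dimvf /= /dim /= muln1.
have : alpha \in limg (f w0) by rewrite img memvf.
by case/memv_imgP => u _ ->; exists u.
Qed.

(** If the multipliers vanish, the quadratic form of [h] vanishes on the image of
the polar map [w |-> f w w]. This map is submersive at [w0], so the form is zero;
the proof takes two derivatives at [w0]. *)
Lemma chi_zero : (forall w, chiA w = 0) -> forall alpha, h alpha = 0.
Proof.
move=> chi0; have ks w u v z : T v z (k w u) = T w u (k v z).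
  have := antisym_id w u v z; rewrite !chi0 !mul0r !addr0 !subr0 mulr0.
  by move/eqP; rewrite mulf_eq0 pnatr_eq0 /= subr_eq0 => /eqP.
have Mz w u v z : T v z (k w u) + T u z (k w v) + T u v (k w z) = 0.
  by rewrite prolongation_id !chi0; ring.
have k00 : k w0 w0 = 0.
  apply: hess_inj => z; have := Mz w0 w0 w0 z.
  rewrite (ks w0 z w0 w0) -(f_swap23 w0 z) => E; apply/eqP.
  have : 3 * T w0 z (k w0 w0) = 0 by rewrite -[RHS]E; ring.
  by rewrite f_swap23 => /eqP; rewrite mulf_eq0 pnatr_eq0.
have k0 u : k w0 u = 0.
  apply: hess_inj => z; have := Mz w0 w0 u z.
  rewrite k00 (ks w0 z w0 u) => E; apply/eqP.
  have : 2 * T w0 z (k w0 u) = 0.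
    by rewrite -[RHS]E f0r; ring.
  by rewrite f_swap23 => /eqP; rewrite mulf_eq0 pnatr_eq0.
by move=> alpha; have [u <-] := hess_surj alpha; apply: k0.
Qed.

(** Otherwise [antisym_id] makes [chiA v * f w0 u z + chiA z * f w0 u v] of the form
[f v z (g u)]. Putting [v = w0] determines [g], which turns out to be onto. With
[v = z] this says that every derivative of the cubic is divisible by [chiA]; by
Euler's relation so is the cubic. *)
Lemma half_coefficient v1 : chiA v1 != 0 -> 1 - 2 * a = 0.
Proof.
move=> nv1; apply/eqP/negPn/negP => nc.
have nw0 : w0 != 0.
  apply: contraTneq (nv1) => w00; rewrite (_ : v1 = 0) ?(is_linear0 chi_lin) ?eqxx //.
  apply: hess_inj => z; rewrite /T w00; exact: is_linear0 (trilinear_l f v1 z).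
have [s0 s0E] : exists s0, forall z, T w0 s0 z = chiA z.
  pose L : {linear W -> K^o} := HB.pack chiA (GRing.isLinear.Build K W K^o *:%R chiA chi_lin).
  have [s0 s0E] := hess_surj (linfun L); exists s0 => z.
  by rewrite /T s0E lfunE.
pose g u := chiA w0 *: u + T w0 w0 u *: s0.
have gE u v z : T v z (g u) = chiA v * T w0 u z + chiA z * T w0 u v.
  have [q qE] := hess_surj (f w0 u \o (h \o f w0))%VF.
  have qT s : T w0 q s = T w0 u (k w0 s) by rewrite /T qE !comp_lfunE.
  have qvz v' z' : T w0 u (k v' z') = T v' z' q.
    have [s sE] := hess_surj (f v' z').
    have -> : k v' z' = k w0 s by rewrite /h_at sE.
    by rewrite -qT f_swap23 /T sE.
  have [r rE] : exists r, forall v' z',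
      T v' z' r = chiA v' * T w0 u z' + chiA z' * T w0 u v'.
    exists (- (1 - 2 * a)^-1 *:
      (2 *: (k w0 u - q) - (1 - 2 * a) *: (chiA w0 *: u + chiA u *: w0))) => v' z'.
    have E := antisym_id w0 u v' z'; rewrite qvz in E.
    rewrite !f_linE E (f_swap23 v' z' u) (f_swap12 v' u) (f_swap23 v' z' w0) (f_swap12 v' w0).
    by field.
  suff -> : g u = r by [].
  apply/eqP; rewrite -subr_eq0; apply/eqP/hess_inj => z'.
  by rewrite f_swap23 /g !f_linE rE (f_swap23 w0 z' u) (f_swap23 w0 z' s0) s0E (f_swap23 w0 u w0); ring.
have w0chi : chiA w0 != 0.
  apply/negP => /eqP chi0.
  have ker u : T w0 w0 u = 0 -> u = 0.
    move=> u0; have g0 : g u = 0 by rewrite /g chi0 u0 !scale0r addr0.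
    have H v z : chiA v * T w0 u z + chiA z * T w0 u v = 0 by rewrite -gE g0 f0r.
    have H1 : T w0 u v1 = 0.
      have /eqP := H v1 v1; rewrite -mulr2n -mulr_natl mulf_eq0 pnatr_eq0 /=.
      by rewrite mulf_eq0 (negPf nv1) => /eqP.
    apply: hess_inj => z; have /eqP := H v1 z; rewrite H1 mulr0 addr0 mulf_eq0.
    by rewrite (negPf nv1) => /eqP.
  have E : T w0 w0 v1 *: w0 = T w0 w0 w0 *: v1.
    apply/eqP; rewrite -subr_eq0; apply/eqP/ker; rewrite !f_linE; ring.
  have /eqP := congr1 chiA E; rewrite !is_linearZ // chi0 mulr0 eq_sym mulf_eq0.
  by rewrite (negPf nv1) orbF => /eqP /ker w00; rewrite w00 eqxx in nw0.
(* solving g u = z: applying T w0 w0 to both sides first determines T w0 w0 u *)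
pose ginv z := (chiA w0)^-1 *: (z - (T w0 w0 z / (2 * chiA w0)) *: s0).
have tE z : T w0 w0 (ginv z) = T w0 w0 z / (2 * chiA w0).
  by rewrite /ginv !f_linE (f_swap23 w0 w0 s0) s0E; field.
have ginvK z : g (ginv z) = z.
  by rewrite /g tE /ginv scalerA mulfV // scale1r subrK.
apply: (@cubic_not_product _ _ f chiA (fun z z' => 2 * T w0 (ginv z) z')) => //.
  split=> [z' c u v|z c u v]; last by rewrite fDr fZr; ring.
  by rewrite /ginv !f_linE; ring.
move=> z; have := gE (ginv z) z z; rewrite ginvK /T => ->; ring.
Qed.

End Hessian.

Section Half.
Hypothesis a_half : 1 - 2 * a = 0.

Lemma h_at_sym w u v z : T v z (k w u) = T w u (k v z).
Proof.
have /eqP := antisym_id w u v z; rewrite a_half mul0r mulf_eq0 pnatr_eq0 /= subr_eq0.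
by move/eqP.
Qed.

Lemma a_value : a = 2^-1.
Proof.
apply/eqP; rewrite -(inj_eq (mulfI (_ : 2 != 0 :> K))) ?pnatr_eq0 //.
by rewrite mulfV ?pnatr_eq0 // eq_sym -subr_eq0 a_half.
Qed.

Lemma prolongation_half_id w u v z :
  T v z (k w u) + T u z (k w v) + T u v (k w z) =
  - 2^-1 * (chiA w * T u v z + chiA u * T w v z + chiA v * T w u z + chiA z * T w u v).
Proof. by rewrite prolongation_id a_value; field. Qed.

Lemma amapC u v : amap u v = amap v u.
Proof. by rewrite /amap [_ + _ *: u]addrC h_atC. Qed.

(** Membership in the affine cone of the singular locus. *)
Definition singular_vec w : Prop := forall z, T w w z = 0.
(** This symmetric form decides which conics degenerate; [pairing x] is the
coordinate along [x] in the eigenspace decomposition of [amap x] below. *)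
Definition pairing u v : K := chiA (amap u v).

Lemma f_curve u v w t z :
  T (u + t *: v + t ^+ 2 *: w) (u + t *: v + t ^+ 2 *: w) z =
  T u u z + 2 * t * T u v z + t ^+ 2 * (2 * T u w z + T v v z)
  + 2 * t ^+ 3 * T v w z + t ^+ 4 * T w w z.
Proof. by rewrite !f_linE (f_swap12 v u) (f_swap12 w u) (f_swap12 w v); ring. Qed.

Section Conic.
Variables x y : W.
Hypotheses (x_sing : singular_vec x) (y_sing : singular_vec y).
Local Notation B := (amap x y).

(** [amap y] maps a singular vector [x] into its tangent space. *)
Lemma conic_tangent z : T x B z = 0.
Proof.
have := amap_mult y x x z; rewrite !x_sing mulr0 addr0 [T (amap y x) x z]f_swap12 -mulr2n -mulr_natl.
by rewrite amapC => /eqP; rewrite mulf_eq0 pnatr_eq0 => /eqP.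
Qed.

Lemma conic_tangent2 z : T y B z = 0.
Proof.
have := amap_mult x y y z; rewrite !y_sing mulr0 addr0 [T (amap x y) y z]f_swap12 -mulr2n -mulr_natl.
by move/eqP; rewrite mulf_eq0 pnatr_eq0 => /eqP.
Qed.

Lemma amap_twice : amap y B = (chiA y / 2) *: B + (pairing x y / 2) *: y.
Proof.
rewrite {1}/amap -/(pairing x y) a_value [2^-1 * _]mulrC [2^-1 * _]mulrC.
rewrite (_ : k y B = 0) ?addr0 //.
by rewrite (@h_at_eq y B 0 0 0) ?scale0r // => z; rewrite conic_tangent2 mul0r.
Qed.

(** The infinitesimal automorphism [amap y], applied to [conic_tangent]. *)
Lemma conic_second z : T B B z = - (pairing x y / 2) * T x y z.
Proof.
have := amap_mult y B x z.
rewrite amap_twice [T B x (amap y z)]f_swap12 !conic_tangent (f_swap12 B x) conic_tangent.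
rewrite [amap y x]amapC fDl !fZl (f_swap12 B x) conic_tangent (f_swap12 y x) mulr0 add0r !addr0 mulr0 => E.
by apply/eqP; rewrite mulNr -addr_eq0 addrC E.
Qed.

(** By [amap_twice], this curve contains the orbit of [x] under the one-parameter
group generated by [amap y], which preserves the singular locus. Its point at
infinity is [y] if [pairing x y] is nonzero. *)
Lemma conic_singular t : singular_vec (x + t *: B + t ^+ 2 *: ((pairing x y / 4) *: y)).
Proof.
move=> z; rewrite f_curve x_sing conic_second conic_tangent !fZm !fZl.
by rewrite (f_swap12 B y) conic_tangent2 y_sing; field.
Qed.

Lemma line_singular t : pairing x y = 0 -> singular_vec (B + t *: x).
Proof.
move=> d0 z; have := f_curve B x 0 t z; rewrite scaler0 addr0 => ->.
rewrite conic_second d0 (f_swap12 B x) conic_tangent x_sing.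
by rewrite -(scale0r x) !fZm !fZl; ring.
Qed.

End Conic.

Lemma amap_lin w c u v : amap w (c *: u + v) = c *: amap w u + amap w v.
Proof.
rewrite /amap /h_at chi_lin !linearP /=; move: (h _) (h _) => p q.
by apply: vec_ext => phi /is_linearE E; rewrite !E; ring.
Qed.

(** Singular vectors [x] with [chiA x = 1] play the role of primitive idempotents
of a Jordan algebra, and [amap x] that of the multiplication by [x]; what follows
is modelled on the Peirce decomposition. *)
Section Peirce.
Variable x : W.
Hypotheses (x_sing : singular_vec x) (chi_x : chiA x = 1).
Local Notation xi := (pairing x).

Lemma h_at_xx : k x x = 0.
Proof. by rewrite (@h_at_eq x x 0 0 0) ?scale0r // => z; rewrite x_sing mul0r. Qed.

Lemma peirce_half v z : T x z (k x v) = - 2^-1 * T x v z.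
Proof.
have := prolongation_half_id x x v z; rewrite h_at_xx f0r add0r (h_at_sym x z x v) chi_x (x_sing z) (x_sing v).
move=> E; have -> : T x z (k x v) = 2^-1 * (T x z (k x v) + T x z (k x v)) by field.
by rewrite E; field.
Qed.

Lemma amap_x_tangent v z : T x (amap x v) z = 0.
Proof.
by rewrite /amap fDm fDm !fZm x_sing chi_x (f_swap23 x (k x v)) peirce_half a_value; field.
Qed.

Lemma h_at_kernel v : (forall z, T x v z = 0) -> k x v = 0.
Proof. by move=> v0; rewrite (@h_at_eq x v 0 0 0) ?scale0r // => z; rewrite v0 mul0r. Qed.

Lemma amap_x_twice v : amap x (amap x v) = 2^-1 *: amap x v + (2^-1 * xi v) *: x.
Proof.
rewrite {1}/amap h_at_kernel ?addr0; last exact: amap_x_tangent.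
by rewrite chi_x mulr1 a_value.
Qed.

Lemma amap_xx : amap x x = x.
Proof. by rewrite /amap h_at_xx addr0 chi_x mulr1 -scalerDl a_value (_ : 2^-1 + 2^-1 = 1 :> K) ?scale1r //; field. Qed.

Lemma xi_x : xi x = 1. Proof. by rewrite /pairing amap_xx. Qed.

Lemma xi_lin : is_linear xi.
Proof. by move=> c u v; rewrite /pairing amap_lin chi_lin. Qed.

(** The eigenspaces of [amap x] for 1/2 and 0; that for 1 is spanned by [x]. *)
Definition half_space v : Prop := (forall z, T x v z = 0) /\ chiA v = 0.
Definition zero_space w : Prop := amap x w = 0.

Definition half_part z : W := 2 *: (amap x z - xi z *: x).
Definition zero_part z : W := z - 2 *: amap x z + xi z *: x.

Lemma peirce z : z = xi z *: x + half_part z + zero_part z.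
Proof.
rewrite /half_part /zero_part; move: (amap x z) (xi z) => p c.
by apply: vec_ext => phi /is_linearE E; rewrite !E; ring.
Qed.

Lemma half_partP z : half_space (half_part z).
Proof.
split=> [z'|]; last first.
  have E : chiA (amap x z) = xi z by [].
  rewrite /half_part; move: (amap x z) (xi z) E => p c E.
  by rewrite !(is_linearE chi_lin) chi_x E; ring.
by rewrite /half_part fZm fDm fNm fZm amap_x_tangent x_sing; ring.
Qed.

Lemma zero_partP z : zero_space (zero_part z).
Proof.
rewrite /zero_space /zero_part [_ + xi z *: x]addrC amap_lin -scaleNr [z + _]addrC amap_lin.
rewrite amap_xx amap_x_twice; move: (amap x z) (xi z) => p c.
by apply: vec_ext => phi Ephi; rewrite !(is_linearE Ephi) (is_linear0 Ephi); field.
Qed.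

Lemma zero_part_id w : zero_space w -> zero_part w = w.
Proof. by move=> w0; rewrite /zero_part /pairing w0 (is_linear0 chi_lin) scale0r scaler0 subr0 addr0. Qed.

Lemma zero_part_lin c u v : zero_part (c *: u + v) = c *: zero_part u + zero_part v.
Proof.
rewrite /zero_part amap_lin xi_lin; move: (amap x u) (amap x v) (xi u) (xi v) => p q d e.
by apply: vec_ext => phi /is_linearE E; rewrite !E; ring.
Qed.

Lemma half_part_lin c u v : half_part (c *: u + v) = c *: half_part u + half_part v.
Proof.
rewrite /half_part amap_lin xi_lin; move: (amap x u) (amap x v) (xi u) (xi v) => p q d e.
by apply: vec_ext => phi /is_linearE E; rewrite !E; ring.
Qed.

Lemma half_amap v : half_space v -> amap x v = 2^-1 *: v.
Proof.
by case=> v0 chi0; rewrite /amap h_at_kernel // chi_x chi0 mulr1 mulr0 scale0r !addr0 a_value.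
Qed.

Lemma xi_half v : half_space v -> xi v = 0.
Proof. by move=> hv; rewrite /pairing half_amap // is_linearZ // hv.2 mulr0. Qed.

Lemma xi_zero w : zero_space w -> xi w = 0.
Proof. by rewrite /zero_space /pairing => ->; apply: is_linear0. Qed.

(** [amap x] multiplies the cubic by 1, so [f] vanishes on three eigenvectors
unless their eigenvalues add up to 1; this and the next two lemmas are cases of
this rule. *)
Lemma f_zero_zero w w' u : zero_space w -> zero_space w' -> T w w' u = T x w w' * xi u.
Proof.
move=> w0 w0'; have H z : T w w' (amap x z) = T w w' z.
  have := amap_mult x w w' z; rewrite w0 w0' chi_x mul1r.
  by rewrite -(scale0r x) fZl fZm !mul0r !add0r.
have := H u; rewrite -(H (amap x u)) amap_x_twice fDr !fZr H (f_swap23 w w' x) (f_swap12 w x) => E.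
have -> : T w w' u = 2 * (T w w' u - 2^-1 * T w w' u) by field.
by rewrite -{1}E; field.
Qed.

Lemma f_half_half v : half_space v -> T v v v = 0.
Proof.
move=> hv; have := amap_mult x v v v; rewrite half_amap // fZl fZm fZr chi_x => E.
apply/eqP; rewrite -(inj_eq (mulfI (_ : 2^-1 != 0 :> K))) ?invr_eq0 ?pnatr_eq0 // mulr0.
by apply/eqP; rewrite -[RHS](subrr (1 * T v v v)) -{1}E; field.
Qed.

Lemma f_half_zero_zero v w w' : half_space v -> zero_space w -> zero_space w' -> T v w w' = 0.
Proof. by move=> hv w0 w0'; rewrite f_swap12 f_swap23 f_zero_zero // xi_half // mulr0. Qed.

(** The two terms come from the eigenvalues 1, 0, 0 and 1/2, 1/2, 0. *)
Lemma cubic_peirce z (w := zero_part z) (v := half_part z) :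
  T z z z = 3 * xi z * T x w w + 3 * T v v w.
Proof.
have hv : half_space v := half_partP z; have w0 : zero_space w := zero_partP z.
have -> : T z z z = T (xi z *: x + v + w) (xi z *: x + v + w) (xi z *: x + v + w).
  by rewrite -peirce.
move: (xi z) v w hv w0 => c {z} v w hv w0.
have Tvx u : T v x u = 0 by rewrite f_swap12 hv.1.
have Twx u : T w x u = T x w u by rewrite f_swap12.
have xwx : T x w x = 0 by rewrite f_swap23 x_sing.
have xwv : T x w v = 0 by rewrite f_swap23 hv.1.
have vvx : T v v x = 0 by rewrite f_swap23 Tvx.
have vwx : T v w x = 0 by rewrite f_swap23 Tvx.
have vwv : T v w v = T v v w by rewrite f_swap23.
have wvx : T w v x = 0 by rewrite f_swap12.
have wvv : T w v v = T v v w by rewrite f_swap12.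
have vww : T v w w = 0 by rewrite f_half_zero_zero.
have wvw : T w v w = 0 by rewrite f_swap12.
have wwv : T w w v = 0 by rewrite f_swap23.
have wwx : T w w x = T x w w by rewrite f_swap23.
have www : T w w w = 0 by rewrite (f_zero_zero _ w0 w0) xi_zero // mulr0.
rewrite !f_linE !x_sing !hv.1 !Tvx !Twx xwx xwv vvx vwx vwv wvx wvv vww wvw wwv wwx www.
by rewrite (f_half_half hv); ring.
Qed.

(** For [v] in [half_space], the component of [amap v v] in the zero eigenspace. It is the limit point, as
[t] tends to 0, of the curve [square v + t v + t^2 x] of singular vectors. *)
Definition square v : W := k v v - (2^-1 * chiA (k v v)) *: x.

Lemma f_x_h_square v z : half_space v -> T x z (k v v) = - 2^-1 * T v v z.
Proof.
move=> hv; have := prolongation_half_id v v x z; rewrite (h_atC v x) (h_at_kernel hv.1) f0r addr0.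
rewrite hv.2 chi_x (f_swap12 v x z) (f_swap12 v x) !hv.1 (f_swap23 v v x) (f_swap12 v x v) hv.1.
by rewrite addr0 => ->; ring.
Qed.

Lemma f_x_square v z : half_space v -> T x (square v) z = - 2^-1 * T v v z.
Proof. by move=> hv; rewrite /square fDm fNm fZm x_sing f_swap23 f_x_h_square //; ring. Qed.

Lemma square_zero_space v : half_space v -> zero_space (square v).
Proof.
move=> hv; rewrite /zero_space /square addrC -scaleNr amap_lin amap_xx /amap chi_x.
rewrite (@h_at_eq x (k v v) v v (- 2^-1)) => [|z]; last by rewrite f_swap23 f_x_h_square.
move: (k v v) => p; apply: vec_ext => phi Ephi.
by rewrite !(is_linearE Ephi) (is_linear0 Ephi) a_value; field.
Qed.

Lemma f_v_square v z : half_space v -> T v (square v) z = 0.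
Proof.
move=> hv; rewrite /square fDm fNm fZm (f_swap12 v x) hv.1 mulr0 oppr0 addr0.
have E := prolongation_half_id v v v z; rewrite (h_at_sym v z v v) hv.2 (f_half_half hv) in E.
have -> : T v (k v v) z = 3^-1 * (T v z (k v v) + T v z (k v v) + T v z (k v v)).
  by rewrite f_swap23; field.
by rewrite E; ring.
Qed.

Lemma square_singular v z : half_space v -> T (square v) (square v) z = 0.
Proof.
move=> hv; rewrite (f_zero_zero _ (square_zero_space hv) (square_zero_space hv)) (f_x_square _ hv).
by rewrite f_swap23 f_v_square //; ring.
Qed.

Lemma square_curve v t : half_space v -> singular_vec (square v + t *: v + t ^+ 2 *: x).
Proof.
move=> hv z; rewrite f_curve square_singular // (f_swap12 (square v) v) f_v_square //.
by rewrite (f_swap12 (square v) x) f_x_square // (f_swap12 v x) hv.1 x_sing; field.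
Qed.

(** If all squares vanished, only the first term of [cubic_peirce] would be left,
and [xi] would divide the cubic. *)
Lemma square_neq0 : exists2 v, half_space v & square v != 0.
Proof.
apply: contrapT => nsq.
have sq0 v : half_space v -> square v = 0.
  by move=> hv; apply/eqP/negPn/negP => nv; apply: nsq; exists v.
apply: (@cubic_not_product _ _ f xi (fun z z' => 3 * T x (zero_part z) (zero_part z'))) => //.
- exact: xi_lin.
- split=> [z c u v|z c u v]; rewrite zero_part_lin.
    by rewrite fDm fZm; ring.
  by rewrite fDr fZr; ring.
move=> z; rewrite -/(T z z z) cubic_peirce.
have hv := half_partP z; have := f_x_square (zero_part z) hv.
rewrite (sq0 _ hv) => E.
have -> : T (half_part z) (half_part z) (zero_part z) = 0.
  move: (half_part z) (zero_part z) E => v w E.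
  have -> : T v v w = - 2 * (- 2^-1 * T v v w) by field.
  by rewrite -E -(scale0r x) fZm mul0r mulr0.
by rewrite mulr0 addr0; ring.
Qed.

(** If [w] is orthogonal to the zero eigenspace for [f x], it is to everything,
because eigenvectors for other eigenvalues are; then [amap x w = 0] forces
[w = 0]. *)
Lemma zero_nondeg w : zero_space w ->
  (forall w', zero_space w' -> T x w w' = 0) -> w = 0.
Proof.
move=> w0 orth.
have kw : k x w = 0.
  apply: h_at_kernel => z; rewrite (peirce z).
  have := half_partP z; have := zero_partP z.
  move: (xi z) (half_part z) (zero_part z) => c v w' w0' hv.
  rewrite !fDr fZr (f_swap23 x w x) x_sing (f_swap23 x w v) hv.1 orth //; ring.
have wE : amap x w = 2^-1 *: w + (2^-1 * chiA w) *: x.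
  by rewrite /amap kw addr0 chi_x mulr1 a_value.
have wx : w = - chiA w *: x.
  have E0 : 2^-1 *: w + (2^-1 * chiA w) *: x = 0 by rewrite -wE.
  rewrite -[LHS]scale1r -(mulfV (_ : 2 != 0 :> K)) ?pnatr_eq0 // -scalerA.
  rewrite -[X in 2 *: X](addrK ((2^-1 * chiA w) *: x)) E0 sub0r scalerN scalerA mulrA.
  by rewrite mulfV ?pnatr_eq0 // mul1r scaleNr.
have : chiA w = - chiA w by rewrite {1}wx (is_linearE chi_lin) chi_x mulr1.
move/eqP; rewrite -addr_eq0 -mulr2n -mulr_natl mulf_eq0 pnatr_eq0 /= => /eqP cw.
by rewrite wx cw oppr0 scale0r.
Qed.

Lemma zero_space_lin c u v : zero_space u -> zero_space v -> zero_space (c *: u + v).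
Proof. by rewrite /zero_space amap_lin => -> ->; rewrite scaler0 addr0. Qed.

(** On the zero eigenspace the singular vectors are those isotropic for the
nondegenerate form [f x]. If [p] and [y] are not orthogonal, a conic through
them needs a vector [u] orthogonal to both with [f x u u <> 0]. Without such a
[u] the eigenspace is spanned by [p] and [y]. Then all squares, being isotropic,
lie on one of these two lines, and by irreducibility of the half eigenspace all
on that of [p]; so [f x p] divides both terms of [cubic_peirce]. *)
Lemma quadric_curve v0 y (p := square v0) :
  half_space v0 -> p != 0 -> zero_space y -> singular_vec y ->
  (forall t, singular_vec (p + t *: y)) \/
  exists u c, c != 0 /\ forall t, singular_vec (p + t *: u + t ^+ 2 *: (c *: y)).
Proof.
move=> hv0 np y0 y_sing; have p0 : zero_space p := square_zero_space hv0.
have p_sing : singular_vec p by move=> z; apply: square_singular.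
have xpz z : T x p z = - 2^-1 * T v0 v0 z by apply: f_x_square.
clearbody p.
have [gpy|npy] := eqVneq (T x p y) 0.
  left=> t z; have := f_curve p y 0 t z; rewrite scaler0 addr0 => ->.
  by rewrite p_sing y_sing f_zero_zero // gpy -(scale0r x) !fZm !fZl; ring.
right; set g := T x p y in npy.
have gpp : T x p p = 0 by rewrite f_swap12 f_swap23; apply: p_sing.
have gyy : T x y y = 0 by rewrite f_swap12 f_swap23; apply: y_sing.
have gyp : T x y p = g by rewrite f_swap23.
(* the projection of the zero eigenspace along p and y *)
pose rho z := zero_part z - (T x (zero_part z) y / g) *: p - (T x (zero_part z) p / g) *: y.
have rhodef z : rho z = zero_part z - (T x (zero_part z) y / g) *: p
    - (T x (zero_part z) p / g) *: y by [].
clearbody rho.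
have rho0 z : zero_space (rho z).
  rewrite rhodef -!scaleNr addrC; apply: zero_space_lin => //; rewrite addrC.
  by apply: zero_space_lin => //; apply: zero_partP.
have rhop z : T x p (rho z) = 0.
  have := rhodef z; move: (zero_part z) (rho z) => w r ->.
  by rewrite !f_linE gpp (f_swap23 x p w) -/g; field.
have rhoy z : T x y (rho z) = 0.
  have := rhodef z; move: (zero_part z) (rho z) => w r ->.
  by rewrite !f_linE gyy (f_swap23 x y w) gyp; field.
apply: contrapT => nu.
have iso u : zero_space u -> T x p u = 0 -> T x y u = 0 -> T x u u = 0.
  move=> u0 pu yu; apply/eqP/negPn/negP => nuu; apply: nu.
  exists u, (- (T x u u) / (2 * g)); split.
    by rewrite mulf_neq0 ?oppr_eq0 ?invr_eq0 ?mulf_neq0 ?pnatr_eq0.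
  move=> t z; rewrite f_curve p_sing !fZm !fZl y_sing (f_zero_zero _ p0 u0) pu.
  rewrite (f_zero_zero _ p0 y0) (f_zero_zero _ u0 u0) (f_zero_zero _ u0 y0) -/g (f_swap23 x u y) yu.
  by field.
have rhoE z : rho z = 0.
  apply: zero_nondeg => // w w0.
  have wE : w = (T x w y / g) *: p + ((T x w p / g) *: y + rho w).
    rewrite rhodef (zero_part_id w0); move: (T x w y / g) (T x w p / g) => c d.
    by apply: vec_ext => phi /is_linearE E; rewrite !E; ring.
  rewrite wE !fDr !fZr (f_swap23 x (rho z) p) rhop (f_swap23 x (rho z) y) rhoy !mulr0 !add0r.
  have H1 := iso _ (rho0 z) (rhop z) (rhoy z); have H2 := iso _ (rho0 w) (rhop w) (rhoy w).
  have := iso (1 *: rho z + rho w) (zero_space_lin _ (rho0 z) (rho0 w)).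
  move: (rho z) (rho w) (rhop z) (rhop w) (rhoy z) (rhoy w) H1 H2 => r r' pr pr' yr yr' H1 H2.
  rewrite !f_linE pr pr' yr yr' H1 H2 (f_swap23 x r' r) => H.
  have /eqP : 2 * T x r r' = 0 by rewrite -[RHS]H ?mulr0 ?addr0 //; ring.
  by rewrite mulf_eq0 pnatr_eq0 => /eqP.
have zE z : zero_part z = (T x (zero_part z) y / g) *: p + (T x (zero_part z) p / g) *: y.
  by apply/eqP; rewrite -subr_eq0 opprD addrA -rhodef rhoE.
have sqp v : half_space v -> T v v p = 0.
  move=> hv.
  have prod u : half_space u -> T u u p * T u u y = 0.
    move=> hu; have s0 := square_zero_space hu.
    have ss : T x (square u) (square u) = 0 by rewrite f_swap12 f_swap23; apply: square_singular.
    have sp : T x (square u) p = - 2^-1 * T u u p by apply: f_x_square.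
    have sy : T x (square u) y = - 2^-1 * T u u y by apply: f_x_square.
    have := zE (square u); rewrite (zero_part_id s0) sp sy; move: (square u) ss sp sy.
    move=> s ss sp sy sE; move: ss; rewrite {2}sE fDr !fZr sp sy => ss.
    have -> : T u u p * T u u y = 2 * g * (- 2^-1 * T u u y / g * (- 2^-1 * T u u p)
      + - 2^-1 * T u u p / g * (- 2^-1 * T u u y)) by field.
    by rewrite ss mulr0.
  (* a product of two quadratic forms vanishing on the line v + t v0 *)
  pose q w : {poly K} := (T v v w)%:P + (2 * T v v0 w) *: 'X + (T v0 v0 w) *: 'X^2.
  have qE w t : (q w).[t] = T (v + t *: v0) (v + t *: v0) w.
    rewrite /q !(hornerD, hornerZ, hornerC, hornerX, hornerXn) !f_linE (f_swap12 v0 v); ring.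
  have /eqP : q p * q y = 0.
    apply: poly_fun_eq0 => t _; rewrite hornerM !qE; apply: prod; split=> [z|].
      by rewrite fDm fZm hv.1 hv0.1; ring.
    by rewrite !(is_linearE chi_lin) hv.2 hv0.2; ring.
  rewrite mulf_eq0 => /orP[] /eqP q0.
    have := congr1 (fun r : {poly K} => r.[0]) q0; rewrite horner0 qE scale0r addr0 //.
  have := congr1 (fun r : {poly K} => r`_2) q0; rewrite /q !coefD !coefZ coefC coefX coefXn coef0 /=.
  rewrite mulr0 mulr1 !add0r => vy; move: npy; rewrite /g xpz vy mulr0 eqxx //.
apply: (@cubic_not_product _ _ f (fun z => T x (zero_part z) p / g)
  (fun z z' => 6 * xi z * T x (zero_part z') y + 3 * T (half_part z) (half_part z') y)) => //.
- move=> c u v; rewrite zero_part_lin fDm fZm; ring.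
- split=> [z c u v|z c u v].
    by rewrite half_part_lin xi_lin !f_linE; ring.
  by rewrite zero_part_lin half_part_lin !f_linE; ring.
move=> z; rewrite -/(T z z z) cubic_peirce.
have := sqp _ (half_partP z); have := zE z.
move: (half_part z) (xi z) (zero_part z) => v c w wE vp.
have -> : T v v w = T x w p / g * T v v y.
  by rewrite {1}wE fDr !fZr vp mulr0 add0r.
have gw : T x w w = 2 * (T x w y * T x w p) / g.
  by rewrite {2}wE fDr !fZr; field.
rewrite gw. by field.
Qed.

End Peirce.
End Half.
End Prolongation.

(** * The singular locus is irreducible *)

Section SingularLocus.
Variables (K : numClosedFieldType) (W : vectType K) (f : trilinear W).
Hypothesis f_sym : symmetric_trilinear f.
Hypothesis f_irr : irreducible_mpoly (cubic_poly f).

(** Otherwise, on each line transversal to the hyperplane [phi = 0] the cubic would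
have no zero but the point in the hyperplane, so it would be a constant times
the cube of [phi]. *)
Lemma zeros_not_in_hyperplane (phi : W -> K) w1 : is_linear phi -> phi w1 != 0 ->
  ~ (forall w, f w w w = 0 :> K -> phi w = 0).
Proof.
move=> L nw1 f0; set c : K := f w1 w1 w1.
have nc : c != 0 by apply: contra nw1 => /eqP /f0 ->.
have key v t : phi v = 0 -> f (v + t *: w1) (v + t *: w1) (v + t *: w1) = c * t ^+ 3 :> K.
  move=> v0.
  pose q : {poly K} := (f v v v : K)%:P + (3 * (f v v w1 : K)) *: 'X
    + (3 * (f v w1 w1 : K)) *: 'X^2 + c *: 'X^3.
  have qE s : q.[s] = f (v + s *: w1) (v + s *: w1) (v + s *: w1).
    by rewrite cubicD // /q !(hornerD, hornerZ, hornerC, hornerX, hornerXn) -/c; ring.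
  have q3 : q`_3 = c by rewrite /q !coefD !coefZ coefC coefX !coefXn /=; ring.
  have sq : size q = 4%N.
    apply/eqP; rewrite eqn_leq; apply/andP; split; last first.
      by rewrite ltnNge; apply/negP => /leq_sizeP/(_ 3 isT); rewrite q3; apply/eqP.
    apply/leq_sizeP => j lej; rewrite /q !coefD !coefZ coefC coefX !coefXn.
    by case: j lej => [|[|[|[|j]]]] //= _; ring.
  have [r rE] := closed_field_poly_normal q.
  have r0 s : s \in r -> s = 0.
    move=> sr; have : root q s.
      rewrite rE rootZ ?root_prod_XsubC // lead_coef_eq0 -size_poly_gt0 sq //.
    rewrite rootE qE => /eqP /f0; rewrite (is_linearE L) v0 add0r (is_linearE L).
    by move/eqP; rewrite mulf_eq0 (negPf nw1) orbF => /eqP.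
  have lq : lead_coef q = c by rewrite lead_coefE sq.
  have prodE : \prod_(z <- r) ('X - z%:P) = 'X^(size r) :> {poly K}.
    rewrite big_seq (eq_bigr (fun=> 'X)) => [|s /r0 ->]; last by rewrite subr0.
    by rewrite -big_seq big_const_seq count_predT iter_mulr_1.
  have sr : size r = 3%N.
    have := congr1 (fun p : {poly K} => size p) rE.
    by rewrite sq prodE lq size_scale // size_polyXn => -[].
  by rewrite -qE rE prodE sr lq hornerZ hornerXn.
apply: (@cubic_not_product _ _ f phi (fun z z' => c / phi w1 ^+ 3 * phi z * phi z')) => //.
  by split=> [z a u v|z a u v]; rewrite L; ring.
move=> z; pose t := phi z / phi w1.
have zE : z = (z - t *: w1) + t *: w1 by rewrite subrK.
rewrite [in LHS]zE key ?(is_linearE L) /t; last by rewrite mulfVK // subrr.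
by field.
Qed.

Lemma cone_limit (T : set (projpt W)) (p q r : W) : closed_alg T -> T !=set0 ->
  (forall t, t != 0 -> cone T (p + t *: q + t ^+ 2 *: r)) -> cone T p.
Proof.
move=> [P Ph TE] [x Tx] Tpqr; have [->|np] := eqVneq p 0; first by exists x => //; apply: mem0v.
have [y yE] := projptP np; have py : p \in val y by rewrite yE memv_line.
exists y => //; rewrite TE => F PF; have [d Fh] := Ph F PF.
apply/(vanishes_atP Fh py np); have [G GE] := centre p (vbasisP _) F.
have G0 : on_curve (vbasis {:W}) q r G = 0.
  apply: poly_fun_eq0 => t nt; rewrite (on_curveE _ p) GE.
  have [z Tz wz] := Tpqr t nt; move: Tz; rewrite TE => /(_ F PF); exact.
have := on_curveE (vbasis {:W}) p q r G 0.
by rewrite G0 horner0 scale0r expr0n scale0r !addr0 GE => <-.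
Qed.

(** The point at infinity of a curve in a closed set belongs to this set. *)
Lemma curve_end (T : set (projpt W)) (p q r : W) : closed_alg T -> T !=set0 ->
  (forall t, cone T (p + t *: q + t ^+ 2 *: r)) -> cone T r.
Proof.
move=> Tcl T0 Tpqr; apply: (@cone_limit T r q p Tcl T0) => t nt.
have := coneZ (t ^+ 2) (Tpqr t^-1); congr (cone T _).
apply: vec_ext => phi /is_linearE E; rewrite !E; field.
by [].
Qed.

Lemma line_end (T : set (projpt W)) (p q : W) : closed_alg T -> T !=set0 ->
  (forall t, cone T (p + t *: q)) -> cone T q.
Proof.
move=> Tcl T0 Tpq; apply: (@cone_limit T q p 0 Tcl T0) => t nt.
have := coneZ t (Tpq t^-1); congr (cone T _).
apply: vec_ext => phi /[dup] /is_linearE E /is_linear0 E0; rewrite !E E0; field.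
by [].
Qed.

Variables (h : 'Hom(dual W, W)) (a : K) (chiA : W -> K).
Hypothesis chi_lin : is_linear chiA.
Hypothesis amap_mult : forall w u v z,
  f (amap f h a chiA w u) v z + f u (amap f h a chiA w v) z + f u v (amap f h a chiA w z)
  = chiA w * f u v z :> K.
Hypothesis a_half : 1 - 2 * a = 0.
Hypothesis Sing_nonsingular : nonsingular (Sing f).

(** The branch [T] at [x] is the whole singular locus: it contains the vectors not
orthogonal to [x] for [pairing] ([open_T]), so it contains all irreducible closed
subsets through [x] ([max_T]), and these reach the remaining vectors. *)
Lemma Sing_irreducible x : cone (Sing f) x -> chiA x = 1 -> irreducible_alg (Sing f).
Proof.
move=> Sx chi_x; have x_sing : singular_vec f x := cone_Sing f_sym Sx.
have S0 : Sing f !=set0 by case: (Sx) => z Sz _; exists z.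
have singS w : singular_vec f w -> cone (Sing f) w.
  have [->|nw] := eqVneq w 0; last exact: Sing_cone.
  by case: S0 => z Sz _; exists z => //; apply: mem0v.
pose B := amap f h a chiA x; pose xi := pairing f h a chiA x.
have xix : xi x = 1 by apply: xi_x.
have nx : x != 0.
  by apply: contraTneq (oner_neq0 K) => x0; rewrite -chi_x x0 (is_linear0 chi_lin) eqxx.
have branch e : singular_vec f e -> e != 0 -> exists T, [/\ irreducible_alg T, cone T e,
    T `<=` Sing f & forall q r, (forall t, singular_vec f (e + t *: q + t ^+ 2 *: r)) ->
    forall t, cone T (e + t *: q + t ^+ 2 *: r)].
  move=> /singS [z Sz ez] ne.
  have [T [Tirr Tz TS Tcurve]] := nonsingular_branch (Sing_nonsingular Sz) ne ez.
  exists T; split=> // [|q r qr]; first by exists z.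
  by apply: Tcurve => t; apply: singS.
have [T [Tirr Tx TS Tcurve]] := branch x x_sing nx.
have [Tcl T0 _] := Tirr.
have open_T y : singular_vec f y -> xi y != 0 -> cone T y.
  move=> y_sing ny.
  have /(curve_end Tcl T0) := Tcurve _ _ (conic_singular f_sym amap_mult a_half x_sing y_sing).
  rewrite -/(xi y) => /(coneZ (xi y / 4)^-1); rewrite scalerA mulVf ?scale1r //.
  by rewrite mulf_neq0 ?invr_eq0 ?pnatr_eq0.
have max_T T' : irreducible_alg T' -> T' `<=` Sing f -> cone T' x -> T' `<=` T.
  move=> [_ _ irrT'] T'S [z T'z xz].
  have [] := irrT' T [set y : projpt W | forall w, w \in val y -> xi w = 0] => //.
  - by apply: closed_linear; apply: xi_lin.
  - move=> y T'y; have [w nw yE] := projpt_gen y.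
    have wy : w \in val y by rewrite yE memv_line.
    have [xw|nxw] := eqVneq (xi w) 0.
      right=> w' /=; rewrite yE => /vlineP[c ->].
      by rewrite /xi (is_linearZ _ _ (xi_lin f h a chi_lin x)) -/(xi w) xw mulr0.
    left; apply: (coneP wy nw); apply: open_T => //.
    by apply: (cone_Sing f_sym); exists y => //; apply: T'S.
  by move=> /(_ z T'z x xz) /eqP; rewrite xix oner_eq0.
have via y' (T' : set (projpt W)) : irreducible_alg T' -> T' `<=` Sing f ->
    cone T' x -> cone T' y' -> cone T y'.
  by move=> T'irr T'S T'x; apply: coneS; apply: max_T.
suff ST : Sing f = T by rewrite ST.
apply/seteqP; split=> // z Sz.
have [y ny zE] := projpt_gen z; have yz : y \in val z by rewrite zE memv_line.
apply: (coneP yz ny).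
have y_sing : singular_vec f y by apply: (cone_Sing f_sym); exists z.
have [xy|] := eqVneq (xi y) 0; last exact: open_T.
have [B0|nB] := eqVneq (B y) 0.
  have [v hv np] := square_neq0 f_sym f_irr chi_lin amap_mult a_half x_sing chi_x.
  have p_sing : singular_vec f (square f h chiA x v).
    by move=> w; apply: (square_singular f_sym chi_lin amap_mult a_half x_sing chi_x).
  have [T' [T'irr T'p T'S T'curve]] := branch _ p_sing np.
  have [T'cl T'0 _] := T'irr.
  apply: (via y T') => //.
    apply: (curve_end T'cl T'0 (T'curve v x _)) => t.
    exact: (square_curve f_sym chi_lin amap_mult a_half x_sing chi_x).
  have [line|[u [c [nc conic]]]] :=
    quadric_curve f_sym f_irr chi_lin amap_mult a_half x_sing chi_x hv np B0 y_sing.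
    apply: (line_end T'cl T'0 (p := square f h chiA x v)) => t.
    by have := T'curve y 0 _ t; rewrite scaler0 addr0; apply=> s; rewrite scaler0 addr0.
  have /(coneZ c^-1) := curve_end T'cl T'0 (T'curve _ _ conic).
  by rewrite scalerA mulVf ?scale1r.
have B_sing : singular_vec f (B y).
  move=> w; have := line_singular f_sym amap_mult a_half x_sing y_sing 0 xy w.
  by rewrite scale0r addr0.
have [T' [T'irr T'p T'S T'curve]] := branch _ B_sing nB.
have [T'cl T'0 _] := T'irr.
have line_T w : (forall t, singular_vec f (B y + t *: w)) -> cone T' w.
  move=> Bw; apply: (line_end T'cl T'0 (p := B y)) => t.
  by have := T'curve w 0 _ t; rewrite scaler0 addr0; apply=> s; rewrite scaler0 addr0.
apply: (via y T') => //; apply: line_T => t.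
  exact: line_singular.
have := line_singular f_sym amap_mult a_half y_sing x_sing t.
by rewrite /pairing (amapC f_sym h a chiA y x); apply.
Qed.

End SingularLocus.

(** * Multipliers *)

Section Chi.
Variables (K : numClosedFieldType) (W : vectType K) (f : trilinear W).

Lemma multiplier_unique phi c c' : cubic_poly f != 0 ->
  multiplier f phi c -> multiplier f phi c' -> c = c'.
Proof.
move=> nf mc mc'.
have [w nw] : exists w, f w w w != 0 :> K.
  apply: contrapT => /forallNP f0; case/eqP: nf; apply: evalp_inj => w.
  rewrite evalp_cubic; have /negP/negPn/eqP -> := f0 w.
  by rewrite /evalp meval0.
by apply: (mulIf nw); rewrite -mc -mc'.
Qed.

Lemma chiP phi : aut f phi -> multiplier f phi (chi f phi).
Proof. by move=> fphi; apply: (xgetPex 0 fphi). Qed.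

Lemma chi_linear (A : 'Hom(W, 'End(W))) : cubic_poly f != 0 -> aut1 f A ->
  is_linear (fun w => chi f (A w)).
Proof.
move=> nf [_ fA] c u v; apply: (multiplier_unique nf (chiP (fA _))) => x y z.
rewrite linearP /= !add_lfunE !scale_lfunE.
have := chiP (fA u) x y z; have := chiP (fA v) x y z.
move: (A u) (A v) => p q.
rewrite !(is_linearE (trilinear_l f _ _)) !(is_linearE (trilinear_m f _ _)).
rewrite !(is_linearE (trilinear_r f _ _)) => E1 E2.
rewrite mulrDl -E1 -[c * _ * _]mulrA -E2; ring.
Qed.

Lemma amap_nonzero (h : 'Hom(dual W, W)) (A : 'Hom(W, 'End(W))) : A != 0 ->
  (forall u v, A u v = h (f u v)) -> exists alpha, h alpha != 0.
Proof.
move=> nA AE; apply: contrapT => /forallNP h0; case/eqP: nA.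
apply/lfunP => u; apply/lfunP => v; rewrite AE !zero_lfunE.
by have /negP/negPn/eqP := h0 (f u v).
Qed.

End Chi.

Theorem theorem6p1 (R : realType) (W : vectType R[i]) (f : trilinear W)
    (f_sym : symmetric_trilinear f)
    (f_irr : irreducible_mpoly (cubic_poly f))
    (f_hess : nonzero_hessian f)
    (sing_nonsingular : nonsingular (Sing f))
    (prolongation : exists (A : 'Hom(W, 'End(W))) (h : 'Hom(dual W, W)) (a : R[i]),
       [/\ aut1 f A, A != 0, a != 4%:R^-1 &
           forall u v : W,
             A u v = (a * chi f (A u)) *: v + (a * chi f (A v)) *: u + h (f u v)])
    (Y_secant : hypersurface f = secant_variety (Sing f)) :
  exists2 S : set (projpt W),
    irreducible_component (Sing f) S & hypersurface f = secant_variety S.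
Proof.
have [A [h [a [fA nA _ AE]]]] := prolongation.
pose chiA w := chi f (A w).
have nf : cubic_poly f != 0 by case: f_irr.
have chi_lin : is_linear chiA := chi_linear nf fA.
have amapE u v : amap f h a chiA u v = A u v by rewrite AE.
have mult w u v z : f (amap f h a chiA w u) v z + f u (amap f h a chiA w v) z
    + f u v (amap f h a chiA w z) = chiA w * f u v z :> R[i].
  by rewrite !amapE; apply: chiP; case: fA.
have [w0 hess] := f_hess.
have [w1 nw1] : exists w1, chiA w1 != 0.
  apply: contrapT => /forallNP chi0'.
  have chi0 w : chiA w = 0 by have /negP/negPn/eqP := chi0' w.
  have h0 := chi_zero f_sym mult hess chi0.
  have [|alpha] := @amap_nonzero _ _ f h A nA.
    by move=> u v; rewrite AE -/(chiA u) -/(chiA v) !chi0 mulr0 !scale0r !add0r.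
  by rewrite h0 eqxx.
have a_half := half_coefficient f_sym f_irr chi_lin mult hess nw1.
have [x Sx nx] : exists2 x, cone (Sing f) x & chiA x != 0.
  apply: contrapT => nS; apply: (zeros_not_in_hyperplane f_sym f_irr chi_lin nw1) => w fw.
  have [->|nw] := eqVneq w 0; first exact: is_linear0.
  pose H := [set x : projpt W | forall w, w \in val x -> chiA w = 0].
  have Hcl : closed_alg H by apply: closed_linear.
  have [z zE] := projptP nw; have wz : w \in val z by rewrite zE memv_line.
  have Yz : hypersurface f z.
    move=> w'; rewrite zE => /vlineP[c ->].
    rewrite (is_linearE (trilinear_l f _ _)) (is_linearE (trilinear_m f _ _)).
    by rewrite (is_linearE (trilinear_r f _ _)) fw !mulr0.
  move: Yz; rewrite Y_secant => /(_ H Hcl) Hz; apply: (Hz _ w wz).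
  move=> y [u [v [Su Sv _ yuv]]] w' /(subvP yuv) /memv_addP[p pu [q qv ->]].
  have Sing0 z' p' : Sing f z' -> p' \in val z' -> chiA p' = 0.
    move=> Sz' pz'; apply/eqP/negPn/negP => np; apply: nS; exists p' => //.
    by exists z'.
  by rewrite (is_linearD _ _ chi_lin) (Sing0 u) // (Sing0 v) // addr0.
exists (Sing f) => //; split=> // [|T _ TS ST]; last exact/seteqP.
apply: (Sing_irreducible f_sym f_irr chi_lin mult a_half sing_nonsingular
  (x := (chiA x)^-1 *: x)).
  exact: coneZ.
by rewrite (is_linearZ _ _ chi_lin) mulVf.
Qed.
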